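(* Let $u'''=f(x,u,u',u'')$ be a scalar third-order ODE, with $f$ smooth, and let $I_1,I_2,I_3,J_3,I_4,I_5,I_7,I_9,K$ be the functions of $(x,u,p,q)$ defined in the context, where $I_3\neq 0$. Then the equation is locally equivalent, via a contact transformation, to the canonical form $$\bar u'''=s\,\bar u'+\bar u,\qquad s=\text{const},$$ (an equation admitting a five-dimensional Lie symmetry algebra) if and only if the following expressions vanish identically: $$\begin{aligned} I_6&=\tfrac{2}{3}J_{3_q}I_1-\tfrac{1}{3}I_{1_q}J_3-2J_{3_p}+2J_3I_4I_5,\\ I_8&=I_{4_q},\\ I_{10}&=I_4\hat D_xI_7-J_3I_{7_p}+J_3^2\Big(\tfrac{I_4}{J_3}\Big)_u,\\ I_{11}&=J_{3_u}-\hat D_xI_7,\\ I_{12}&=6I_1J_3(I_5I_7-I_4\hat D_xI_5)-18J_3^3I_4+6I_{5_p}I_1J_3^2-18I_2J_3I_4I_5-18J_3I_7\hat D_xI_5\\ &\quad+18J_3^2I_{5_u}+18I_2\hat D_xI_4+2I_1^2I_7-9I_{2_p}J_3+6J_3^2\Big(\tfrac{I_1}{J_3}\Big)_u+36I_2I_7,\\ &K_x,\ K_u,\ K_p,\ K_q . \end{aligned}$$ Moreover, in that case the constant $s$ in the canonical form is $s=K$.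
   Context: Coordinates on the second-order jet space are $(x,u,p,q)$ with $p=u'$, $q=u''$; subscripts denote partial derivatives. $\hat D_x=\partial_x+p\,\partial_u+q\,\partial_p+f(x,u,p,q)\,\partial_q$ is the total derivative along the equation. A contact transformation is a local diffeomorphism $\bar x=\varphi(x,u,p)$, $\bar u=\psi(x,u,p)$, $\bar p=\chi(x,u,p)$ with nonzero Jacobian satisfying $d\bar u-\bar p\,d\bar x=\lambda(du-p\,dx)$ for some function $\lambda(x,u,p)$; two third-order ODEs are equivalent if the (prolonged) transformation maps the solutions of one onto the solutions of the other. Define $I_1=-f_q$, $I_2=-\tfrac{2}{9}I_1^2-f_p-\tfrac13\hat D_xI_1$, $I_3=-\tfrac13 I_1I_2-f_u-\tfrac12\hat D_xI_2$, $J_3=I_3^{1/3}$ (the real cube root, so $I_3=J_3^3$), $I_4=J_{3_q}$, $I_5=\frac{1}{3J_3^2}(I_1J_3+3\hat D_xJ_3)$, $I_7=-I_{5_q}J_3^2$, $I_9=2J_3\hat D_xI_5-I_2+J_3^2I_5^2$, $K=I_9/J_3^2$. *)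

(* Defs.v *)
From Stdlib Require Import Reals Lra List.
From Coquelicot Require Import Coquelicot.
Open Scope R_scope.

(** Functions on the second-order jet space (x,u,p,q), and on (x,u,p). *)
Definition fun4 := R -> R -> R -> R -> R.
Definition fun3 := R -> R -> R -> R.
Definition set4 := R -> R -> R -> R -> Prop.
Definition set3 := R -> R -> R -> Prop.

Definition cbrt (a : R) : R :=
  if Rlt_dec 0 a then Rpower a (1/3)
  else if Rlt_dec a 0 then - Rpower (- a) (1/3) else 0.

Inductive dir4 := Dx | Du | Dp | Dq.

Definition pd (d : dir4) (F : fun4) : fun4 :=
  match d with
  | Dx => fun x u p q => Derive (fun t => F t u p q) x
  | Du => fun x u p q => Derive (fun t => F x t p q) u
  | Dp => fun x u p q => Derive (fun t => F x u t q) p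
  | Dq => fun x u p q => Derive (fun t => F x u p t) q
  end.

Definition ex_pd (d : dir4) (F : fun4) (x u p q : R) : Prop :=
  match d with
  | Dx => ex_derive (fun t => F t u p q) x
  | Du => ex_derive (fun t => F x t p q) u
  | Dp => ex_derive (fun t => F x u t q) p
  | Dq => ex_derive (fun t => F x u p t) q
  end.

Definition iter_pd (ds : list dir4) (F : fun4) : fun4 := fold_right pd F ds.

Definition cont4 (F : fun4) (x u p q : R) : Prop :=
  forall eps, 0 < eps -> exists delta, 0 < delta /\
    forall x' u' p' q', Rabs (x' - x) < delta -> Rabs (u' - u) < delta ->
      Rabs (p' - p) < delta -> Rabs (q' - q) < delta ->
      Rabs (F x' u' p' q' - F x u p q) < eps.

Definition open4 (U : set4) : Prop :=
  forall x u p q, U x u p q -> exists delta, 0 < delta /\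
    forall x' u' p' q', Rabs (x' - x) < delta -> Rabs (u' - u) < delta ->
      Rabs (p' - p) < delta -> Rabs (q' - q) < delta -> U x' u' p' q'.

Definition open3 (V : set3) : Prop :=
  forall x u p, V x u p -> exists delta, 0 < delta /\
    forall x' u' p', Rabs (x' - x) < delta -> Rabs (u' - u) < delta ->
      Rabs (p' - p) < delta -> V x' u' p'.

Definition smooth4 (U : set4) (F : fun4) : Prop :=
  forall ds : list dir4, forall x u p q, U x u p q ->
    cont4 (iter_pd ds F) x u p q /\ (forall d, ex_pd d (iter_pd ds F) x u p q).

Definition smooth3 (V : set3) (F : fun3) : Prop :=
  smooth4 (fun x u p _ => V x u p) (fun x u p _ => F x u p).

Definition fx := pd Dx.
Definition fu := pd Du.
Definition fp := pd Dp.
Definition fq := pd Dq.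

(** Total derivative along u''' = f. *)
Definition Dhat (f F : fun4) : fun4 := fun x u p q =>
  fx F x u p q + p * fu F x u p q + q * fp F x u p q + f x u p q * fq F x u p q.

Definition I1 (f : fun4) : fun4 := fun x u p q => - fq f x u p q.
Definition I2 (f : fun4) : fun4 := fun x u p q =>
  - (2/9) * (I1 f x u p q) ^ 2 - fp f x u p q - (1/3) * Dhat f (I1 f) x u p q.
Definition I3 (f : fun4) : fun4 := fun x u p q =>
  - (1/3) * I1 f x u p q * I2 f x u p q - fu f x u p q
  - (1/2) * Dhat f (I2 f) x u p q.
Definition J3 (f : fun4) : fun4 := fun x u p q => cbrt (I3 f x u p q).
Definition I4 (f : fun4) : fun4 := fq (J3 f).
Definition I5 (f : fun4) : fun4 := fun x u p q =>
  / (3 * (J3 f x u p q) ^ 2) *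
  (I1 f x u p q * J3 f x u p q + 3 * Dhat f (J3 f) x u p q).
Definition I7 (f : fun4) : fun4 := fun x u p q =>
  - fq (I5 f) x u p q * (J3 f x u p q) ^ 2.
Definition I9 (f : fun4) : fun4 := fun x u p q =>
  2 * J3 f x u p q * Dhat f (I5 f) x u p q - I2 f x u p q
  + (J3 f x u p q) ^ 2 * (I5 f x u p q) ^ 2.
Definition K (f : fun4) : fun4 := fun x u p q => I9 f x u p q / (J3 f x u p q) ^ 2.

Definition I6 (f : fun4) : fun4 := fun x u p q =>
  (2/3) * fq (J3 f) x u p q * I1 f x u p q - (1/3) * fq (I1 f) x u p q * J3 f x u p q
  - 2 * fp (J3 f) x u p q + 2 * J3 f x u p q * I4 f x u p q * I5 f x u p q.
Definition I8 (f : fun4) : fun4 := fq (I4 f).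
Definition I10 (f : fun4) : fun4 := fun x u p q =>
  I4 f x u p q * Dhat f (I7 f) x u p q - J3 f x u p q * fp (I7 f) x u p q
  + (J3 f x u p q) ^ 2 * fu (fun x u p q => I4 f x u p q / J3 f x u p q) x u p q.
Definition I11 (f : fun4) : fun4 := fun x u p q =>
  fu (J3 f) x u p q - Dhat f (I7 f) x u p q.
Definition I12 (f : fun4) : fun4 := fun x u p q =>
  let i1 := I1 f x u p q in let i2 := I2 f x u p q in let j3 := J3 f x u p q in
  let i4 := I4 f x u p q in let i5 := I5 f x u p q in let i7 := I7 f x u p q in
  6 * i1 * j3 * (i5 * i7 - i4 * Dhat f (I5 f) x u p q) - 18 * j3 ^ 3 * i4
  + 6 * fp (I5 f) x u p q * i1 * j3 ^ 2 - 18 * i2 * j3 * i4 * i5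
  - 18 * j3 * i7 * Dhat f (I5 f) x u p q + 18 * j3 ^ 2 * fu (I5 f) x u p q
  + 18 * i2 * Dhat f (I4 f) x u p q + 2 * i1 ^ 2 * i7 - 9 * fp (I2 f) x u p q * j3
  + 6 * j3 ^ 2 * fu (fun x u p q => I1 f x u p q / J3 f x u p q) x u p q
  + 36 * i2 * i7.

Definition d3x (F : fun3) : fun3 := fun x u p => Derive (fun t => F t u p) x.
Definition d3u (F : fun3) : fun3 := fun x u p => Derive (fun t => F x t p) u.
Definition d3p (F : fun3) : fun3 := fun x u p => Derive (fun t => F x u t) p.

Definition jac3 (phi psi chi : fun3) (x u p : R) : R :=
  let a := d3x phi x u p in let b := d3u phi x u p in let c := d3p phi x u p in
  let d := d3x psi x u p in let e := d3u psi x u p in let g := d3p psi x u p in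
  let h := d3x chi x u p in let i := d3u chi x u p in let j := d3p chi x u p in
  a * (e * j - g * i) - b * (d * j - g * h) + c * (d * i - e * h).

(** Contact transformation (xbar,ubar,pbar) = (phi,psi,chi) on an open V:
    smooth, nonzero Jacobian, and d psi - chi d phi = lambda (du - p dx). *)
Definition contact_transformation (V : set3) (phi psi chi : fun3) : Prop :=
  open3 V /\ smooth3 V phi /\ smooth3 V psi /\ smooth3 V chi /\
  (forall x u p, V x u p -> jac3 phi psi chi x u p <> 0) /\
  exists lam : fun3, forall x u p, V x u p ->
    d3x psi x u p - chi x u p * d3x phi x u p = - lam x u p * p /\
    d3u psi x u p - chi x u p * d3u phi x u p = lam x u p /\
    d3p psi x u p - chi x u p * d3p phi x u p = 0.

Definition D3 (F : fun3) : fun4 := fun x u p q =>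
  d3x F x u p + p * d3u F x u p + q * d3p F x u p.

(** Prolongation: qbar = D chi / D phi, and the third-order component
    rbar = (Dhat_f qbar) / D phi on the equation u''' = f. *)
Definition qbar (phi chi : fun3) : fun4 := fun x u p q =>
  D3 chi x u p q / D3 phi x u p q.
Definition rbar (f : fun4) (phi chi : fun3) : fun4 := fun x u p q =>
  Dhat f (qbar phi chi) x u p q / D3 phi x u p q.

(** u''' = f (considered on U) is locally equivalent near (x0,u0,p0,q0) by a
    contact transformation to ubar''' = s ubar' + ubar: the prolonged
    transformation maps the equation manifold {r = f} over an open
    neighbourhood W of the point into {rbar = s pbar + ubar}. *)
Definition loc_equiv_canonical (U : set4) (f : fun4) (x0 u0 p0 q0 s : R) : Prop :=
  exists (V : set3) (phi psi chi : fun3) (W : set4),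
    contact_transformation V phi psi chi /\ open4 W /\ W x0 u0 p0 q0 /\
    forall x u p q, W x u p q ->
      U x u p q /\ V x u p /\ D3 phi x u p q <> 0 /\
      rbar f phi chi x u p q = s * chi x u p + psi x u p.

(* Main.v *)
(** Let [phi, psi, chi] be the contact transformation, [lam] its contact factor and
    [a = D phi].  In the linearisation of the equation along its solutions the coframe
    [du - p dx, dp - q dx, dq - f dx] becomes that of the canonical form after rescaling by [lam]
    and reparametrising by [phi]; comparing coefficients gives [I3 = - a^3], hence
    [J3 = - D phi], then [I4 = - phi_p], [I7 = - phi_u], [J3 I5 = D lam / lam] and [K = s].
    Thus [d phi] and [d ln lam] are explicit in terms of the invariants, and the vanishing of
    [I6, I8, I10, I11, I12] says that these two one-forms are closed.
    Conversely, once [phi] and [lam] are found by the Poincare lemma on a box, the vector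
    [Y = (psi, chi, qbar)] has to solve the flat affine system [d Y = A Y d phi + O], with [A]
    the constant companion matrix of [v''' = s v' + v]; multiplied by [exp (- phi A)] it is
    again a closed form to be integrated. *)
From Stdlib Require Import Reals Factorial Lra Lia List.
From Stdlib Require Import FunctionalExtensionality ClassicalDescription ProofIrrelevance.
From Coquelicot Require Import Coquelicot.
(* [Defs] comes last because [Stdlib.Reals] has its own [Dx]. *)
Require Import Defs.
Open Scope R_scope.

(** * Partial derivatives and smoothness *)

(** The obstacle is size: the invariants are nested derivatives of functions that matter only on an
    open set, and expanding them in [f] is hopeless. Smooth functions on an open set are therefore
    made into a differential ring with Leibniz equality, where derivative rules are rewrites and an
    identity ends as a rational identity at a point. The coordinate frame is replaced by [D] and the
    [u]-, [p]- and [q]-derivatives. Its commutators also explain why few expressions suffice: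
    [q]-derivatives of some closedness conditions produce the missing ones. In the flat system only
    the first curl condition is computed, because the Lie derivative along [D/a] commutes with [d]
    and annihilates [d phi], hence carries the condition to the next form. The cube root stays an
    arbitrary unit [j] with its cube prescribed where needed; injectivity of real cubing leaves no
    sign choice. *)

Definition slice (d : dir4) (F : fun4) (x u p q : R) : R -> R :=
  match d with
  | Dx => fun t => F t u p q
  | Du => fun t => F x t p q
  | Dp => fun t => F x u t q
  | Dq => fun t => F x u p t
  end.

Definition coord (d : dir4) : fun4 := fun x u p q =>
  match d with Dx => x | Du => u | Dp => p | Dq => q end.

Lemma pd_slice d F x u p q :
  pd d F x u p q = Derive (slice d F x u p q) (coord d x u p q).
Proof. destruct d; reflexivity. Qed.

Lemma ex_pd_slice d F x u p q :
  ex_pd d F x u p q <-> ex_derive (slice d F x u p q) (coord d x u p q).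
Proof. destruct d; reflexivity. Qed.

Lemma slice_coord d F x u p q : slice d F x u p q (coord d x u p q) = F x u p q.
Proof. destruct d; reflexivity. Qed.

Definition is_pd d (F : fun4) x u p q l :=
  is_derive (slice d F x u p q) (coord d x u p q) l.

Lemma is_pd_pd d F x u p q l : is_pd d F x u p q l -> pd d F x u p q = l.
Proof. rewrite pd_slice. apply is_derive_unique. Qed.

Lemma is_pd_ex d F x u p q l : is_pd d F x u p q l -> ex_pd d F x u p q.
Proof. intro H. apply ex_pd_slice. exists l. exact H. Qed.

Lemma ex_pd_is d F x u p q : ex_pd d F x u p q -> is_pd d F x u p q (pd d F x u p q).
Proof. intro H. unfold is_pd. rewrite pd_slice. apply Derive_correct, ex_pd_slice, H. Qed.

Definition eq_on (W : set4) (F G : fun4) :=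
  forall x u p q, W x u p q -> F x u p q = G x u p q.

Lemma eq_on_sym W F G : eq_on W F G -> eq_on W G F.
Proof. intros H x u p q h. symmetry. now apply H. Qed.

Lemma open4_slice W d x u p q : open4 W -> W x u p q ->
  locally (coord d x u p q)
    (fun t => match d with Dx => W t u p q | Du => W x t p q
              | Dp => W x u t q | Dq => W x u p t end).
Proof.
  intros HW Hw. destruct (HW _ _ _ _ Hw) as [e [He Hb]].
  exists (mkposreal e He). intros t Ht.
  assert (Rabs (t - coord d x u p q) < e) by exact Ht.
  destruct d; simpl in *; apply Hb; auto; rewrite Rminus_diag, Rabs_R0; auto.
Qed.

Lemma slice_eq_on W F G d x u p q : open4 W -> eq_on W F G -> W x u p q ->
  locally (coord d x u p q) (fun t => slice d F x u p q t = slice d G x u p q t).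
Proof.
  intros HW H Hw. generalize (open4_slice W d x u p q HW Hw).
  apply filter_imp. intros t. destruct d; simpl; apply H.
Qed.

Lemma pd_eq_on W F G d : open4 W -> eq_on W F G -> eq_on W (pd d F) (pd d G).
Proof.
  intros HW H x u p q Hw. rewrite !pd_slice. apply Derive_ext_loc.
  now apply (slice_eq_on W).
Qed.

Lemma is_pd_eq_on W F G d x u p q l : open4 W -> eq_on W F G -> W x u p q ->
  is_pd d F x u p q l -> is_pd d G x u p q l.
Proof.
  intros HW H Hw. apply is_derive_ext_loc. now apply (slice_eq_on W).
Qed.

Lemma ex_pd_eq_on W F G d x u p q : open4 W -> eq_on W F G -> W x u p q ->
  ex_pd d F x u p q -> ex_pd d G x u p q.
Proof.
  intros HW H Hw h. apply ex_pd_is in h.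
  eapply is_pd_ex, is_pd_eq_on; eauto.
Qed.

Lemma cont4_eq_on W F G x u p q : open4 W -> eq_on W F G -> W x u p q ->
  cont4 F x u p q -> cont4 G x u p q.
Proof.
  intros HW H Hw Hc e He. destruct (Hc e He) as [d [Hd Hb]].
  destruct (HW _ _ _ _ Hw) as [d' [Hd' Hb']].
  exists (Rmin d d'). split. apply Rmin_pos; auto.
  intros x' u' p' q' h1 h2 h3 h4.
  rewrite <- (H x u p q Hw).
  pose proof (Rmin_l d d'). pose proof (Rmin_r d d').
  rewrite <- H; [apply Hb | apply Hb']; lra.
Qed.

Lemma iter_pd_eq_on W ds F G : open4 W -> eq_on W F G ->
  eq_on W (iter_pd ds F) (iter_pd ds G).
Proof.
  intros HW H. induction ds; simpl; auto. now apply pd_eq_on.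
Qed.

Lemma iter_pd_app ds d F : iter_pd (ds ++ d :: nil) F = iter_pd ds (pd d F).
Proof. unfold iter_pd. now rewrite fold_right_app. Qed.

Lemma smooth4_eq_on W F G : open4 W -> eq_on W F G -> smooth4 W F -> smooth4 W G.
Proof.
  intros HW H HF ds x u p q Hw. destruct (HF ds x u p q Hw) as [Hc He].
  pose proof (iter_pd_eq_on W ds F G HW H) as E. split.
  - now apply (cont4_eq_on W _ _ _ _ _ _ HW E).
  - intro d. now apply (ex_pd_eq_on W _ _ _ _ _ _ _ HW E).
Qed.

Lemma smooth4_subset (U W : set4) F :
  (forall x u p q, W x u p q -> U x u p q) -> smooth4 U F -> smooth4 W F.
Proof. intros H HF ds x u p q Hw. apply HF, H, Hw. Qed.

Lemma smooth4_cont W F x u p q : smooth4 W F -> W x u p q -> cont4 F x u p q.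
Proof. intros H Hw. apply (H nil x u p q Hw). Qed.

Lemma smooth4_ex_pd W F d x u p q : smooth4 W F -> W x u p q -> ex_pd d F x u p q.
Proof. intros H Hw. apply (H nil x u p q Hw). Qed.

Lemma smooth4_is_pd W F d x u p q : smooth4 W F -> W x u p q ->
  is_pd d F x u p q (pd d F x u p q).
Proof. intros. apply ex_pd_is. eapply smooth4_ex_pd; eauto. Qed.

Lemma smooth4_pd W F d : smooth4 W F -> smooth4 W (pd d F).
Proof. intros H ds x u p q Hw. rewrite <- iter_pd_app. now apply H. Qed.

(** Smoothness quantifies over all lists of derivatives; here it is reduced to one differentiation
    step inside a class stable up to equality on [W]. The induction removes the last entry of the
    list, the innermost derivative, because [P] is known for [F] and not for its iterated
    derivatives. *)
Lemma smooth4_coind W (P : fun4 -> Prop) : open4 W ->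
  (forall F x u p q, P F -> W x u p q ->
     cont4 F x u p q /\ forall d, ex_pd d F x u p q) ->
  (forall F d, P F -> exists G, P G /\ eq_on W (pd d F) G) ->
  forall F, P F -> smooth4 W F.
Proof.
  intros HW H1 H2 F HF ds. revert F HF.
  induction ds as [|d ds IH] using rev_ind; intros F HF x u p q Hw.
  - now apply H1.
  - rewrite iter_pd_app. destruct (H2 F d HF) as [G [HG E]].
    destruct (IH G HG x u p q Hw) as [Hc He].
    pose proof (eq_on_sym _ _ _ (iter_pd_eq_on W ds _ _ HW E)) as E'. split.
    + now apply (cont4_eq_on W _ _ _ _ _ _ HW E').
    + intro e. now apply (ex_pd_eq_on W _ _ _ _ _ _ _ HW E').
Qed.

(** The functions generated from smooth ones by ring operations and by outer
    composition with a member of a family [h] satisfying [h n ' = h (n+1)] on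
    [S]; such a class is closed under partial derivatives by construction. *)
Inductive gen (W : set4) : fun4 -> Prop :=
| gen_smooth F : smooth4 W F -> gen W F
| gen_const c : gen W (fun _ _ _ _ => c)
| gen_coord d : gen W (coord d)
| gen_plus F G : gen W F -> gen W G ->
    gen W (fun x u p q => F x u p q + G x u p q)
| gen_mult F G : gen W F -> gen W G ->
    gen W (fun x u p q => F x u p q * G x u p q)
| gen_comp (h : nat -> R -> R) (S : R -> Prop) n F :
    (forall n t, S t -> is_derive (h n) t (h (Datatypes.S n) t)) ->
    gen W F -> (forall x u p q, W x u p q -> S (F x u p q)) ->
    gen W (fun x u p q => h n (F x u p q)).

Lemma is_pd_const d c x u p q : is_pd d (fun _ _ _ _ => c) x u p q 0.
Proof. unfold is_pd. destruct d; exact (is_derive_const (V := R_NormedModule) c _). Qed.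

Definition dir_eqb (d e : dir4) : bool :=
  match d, e with
  | Dx, Dx | Du, Du | Dp, Dp | Dq, Dq => true
  | _, _ => false
  end.

Lemma is_pd_coord d e x u p q :
  is_pd d (coord e) x u p q (if dir_eqb d e then 1 else 0).
Proof.
  unfold is_pd. destruct d, e; simpl;
  try exact (is_derive_const (V := R_NormedModule) _ _);
  exact (is_derive_id (K := R_AbsRing) _).
Qed.

Lemma is_pd_plus d F G x u p q l m : is_pd d F x u p q l -> is_pd d G x u p q m ->
  is_pd d (fun x u p q => F x u p q + G x u p q) x u p q (l + m).
Proof.
  unfold is_pd. intros H1 H2.
  destruct d; exact (is_derive_plus (V := R_NormedModule) _ _ _ _ _ H1 H2).
Qed.

Lemma is_pd_mult d F G x u p q l m : is_pd d F x u p q l -> is_pd d G x u p q m ->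
  is_pd d (fun x u p q => F x u p q * G x u p q) x u p q
    (l * G x u p q + F x u p q * m).
Proof.
  unfold is_pd. intros H1 H2.
  rewrite <- (slice_coord d F), <- (slice_coord d G).
  destruct d; exact (is_derive_mult _ _ _ _ _ H1 H2 Rmult_comm).
Qed.

Lemma is_pd_comp d (h : R -> R) F x u p q l m :
  is_derive h (F x u p q) m -> is_pd d F x u p q l ->
  is_pd d (fun x u p q => h (F x u p q)) x u p q (m * l).
Proof.
  unfold is_pd. intros H1 H2. rewrite Rmult_comm.
  rewrite <- (slice_coord d F) in H1.
  destruct d; exact (is_derive_comp (V := R_NormedModule) _ _ _ _ _ H1 H2).
Qed.

Lemma cont4_const c x u p q : cont4 (fun _ _ _ _ => c) x u p q.
Proof.
  intros e He. exists 1. split. lra. intros. rewrite Rminus_diag, Rabs_R0. auto.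
Qed.

Lemma cont4_coord d x u p q : cont4 (coord d) x u p q.
Proof. intros e He. exists e. split; auto. intros. destruct d; simpl; auto. Qed.

Lemma cont4_op (h : R -> R -> R) F G x u p q :
  continuity_2d_pt h (F x u p q) (G x u p q) ->
  cont4 F x u p q -> cont4 G x u p q ->
  cont4 (fun x u p q => h (F x u p q) (G x u p q)) x u p q.
Proof.
  intros Hh HF HG e He. destruct (Hh (mkposreal e He)) as [d Hd].
  destruct (HF d (cond_pos d)) as [d1 [H1 B1]].
  destruct (HG d (cond_pos d)) as [d2 [H2 B2]].
  exists (Rmin d1 d2). split. apply Rmin_pos; auto.
  pose proof (Rmin_l d1 d2). pose proof (Rmin_r d1 d2).
  intros. apply (Hd _ _); [apply B1 | apply B2]; lra.
Qed.

Lemma cont4_plus F G x u p q : cont4 F x u p q -> cont4 G x u p q ->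
  cont4 (fun x u p q => F x u p q + G x u p q) x u p q.
Proof.
  apply cont4_op. apply (continuity_2d_pt_plus (fun x _ => x) (fun _ y => y)).
  apply continuity_2d_pt_id1. apply continuity_2d_pt_id2.
Qed.

Lemma cont4_mult F G x u p q : cont4 F x u p q -> cont4 G x u p q ->
  cont4 (fun x u p q => F x u p q * G x u p q) x u p q.
Proof.
  apply cont4_op. apply (continuity_2d_pt_mult (fun x _ => x) (fun _ y => y)).
  apply continuity_2d_pt_id1. apply continuity_2d_pt_id2.
Qed.

Lemma cont4_comp (h : R -> R) F x u p q :
  continuity_pt h (F x u p q) -> cont4 F x u p q ->
  cont4 (fun x u p q => h (F x u p q)) x u p q.
Proof.
  intros Hh HF.
  apply (cont4_op (fun y _ => h y) F F x u p q); auto.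
  apply (continuity_1d_2d_pt_comp h (fun y _ => y)); auto.
  apply continuity_2d_pt_id1.
Qed.

Lemma gen_step W F : gen W F ->
  (forall x u p q, W x u p q -> cont4 F x u p q) /\
  forall d, exists G, gen W G /\
    forall x u p q, W x u p q -> is_pd d F x u p q (G x u p q).
Proof.
  induction 1 as [F H | c | d | F G HF [c1 IH1] HG [c2 IH2] | F G HF [c1 IH1] HG [c2 IH2]
                 | h S n F Hh HF [c1 IH1] HS].
  - split. intros. now apply (smooth4_cont W).
    intro d. exists (pd d F). split. now apply gen_smooth, smooth4_pd.
    intros. now apply (smooth4_is_pd W).
  - split. intros. apply cont4_const.
    intro d. exists (fun _ _ _ _ => 0). split. apply gen_const. intros. apply is_pd_const.
  - split. intros. apply cont4_coord.
    intro e. exists (fun _ _ _ _ => if dir_eqb e d then 1 else 0).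
    split. apply gen_const. intros. apply is_pd_coord.
  - split. intros. apply cont4_plus; auto.
    intro d. destruct (IH1 d) as [F' [? ?]], (IH2 d) as [G' [? ?]].
    eexists; split; [| intros; apply is_pd_plus; eauto].
    now apply gen_plus.
  - split. intros. apply cont4_mult; auto.
    intro d. destruct (IH1 d) as [F' [? ?]], (IH2 d) as [G' [? ?]].
    exists (fun x u p q => F' x u p q * G x u p q + F x u p q * G' x u p q).
    split; [| intros; apply is_pd_mult; eauto].
    apply gen_plus; now apply gen_mult.
  - split.
    { intros. apply cont4_comp; auto. apply derivable_continuous_pt.
      apply ex_derive_Reals_0. eexists. apply Hh, HS, H. }
    intro d. destruct (IH1 d) as [F' [? ?]].
    exists (fun x u p q => h (Datatypes.S n) (F x u p q) * F' x u p q).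
    split; [| intros; apply is_pd_comp; eauto].
    apply gen_mult; auto. now apply (gen_comp W h S).
Qed.

Lemma smooth4_gen W F : open4 W -> gen W F -> smooth4 W F.
Proof.
  intro HW. apply (smooth4_coind W (gen W) HW).
  - intros G x u p q HG Hw. destruct (gen_step W G HG) as [H1 H2]. split; auto.
    intro d. destruct (H2 d) as [G' [_ H]]. eapply is_pd_ex, H, Hw.
  - intros G d HG. destruct (gen_step W G HG) as [_ H2].
    destruct (H2 d) as [G' [HG' H]]. exists G'. split; auto.
    intros x u p q Hw. apply is_pd_pd. now apply H.
Qed.

(** * Cube root and reciprocal *)

Lemma cbrt_cube y : cbrt y ^ 3 = y.
Proof.
  assert (H : forall a, 0 < a -> Rpower a (1/3) ^ 3 = a).
  { intros a Ha. rewrite <- Rpower_pow by apply exp_pos.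
    rewrite Rpower_mult. replace (1/3 * INR 3) with 1 by (simpl; field).
    now apply Rpower_1. }
  unfold cbrt. destruct (Rlt_dec 0 y); [now apply H|].
  destruct (Rlt_dec y 0).
  - transitivity (- (Rpower (- y) (1/3)) ^ 3). ring. rewrite H; lra.
  - lra.
Qed.

Lemma cube_inj a b : a ^ 3 = b ^ 3 -> a = b.
Proof.
  intro H. destruct (Req_dec a b) as [|n]; auto. exfalso.
  assert (E : (a - b) * (a * a + a * b + b * b) = 0)
    by (transitivity (a ^ 3 - b ^ 3); [ring | lra]).
  apply Rmult_integral in E. destruct E as [E|E]; [lra|].
  (* Four times the quadratic factor is [(2a + b)^2 + 3 b^2], so its vanishing forces
     [a = b = 0]. *)
  pose proof (Rle_0_sqr (2 * a + b)). pose proof (Rle_0_sqr b). unfold Rsqr in *.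
  assert (Hb : b * b = 0) by lra. apply Rsqr_0_uniq in Hb. subst b.
  apply n, Rsqr_0_uniq. unfold Rsqr. lra.
Qed.

Lemma cbrt_neq_0 y : y <> 0 -> cbrt y <> 0.
Proof. intros H E. apply H. rewrite <- (cbrt_cube y), E. ring. Qed.

(** The form [cbrt y / (3 y)] is valid for both signs, and as a multiple of [cbrt] times a power of
    the reciprocal it has the shape that further differentiation reproduces. *)
Lemma is_derive_cbrt y : y <> 0 -> is_derive cbrt y (cbrt y * / y / 3).
Proof.
  assert (H : forall a, 0 < a ->
            is_derive (fun t => Rpower t (1/3)) a (Rpower a (1/3) * / a / 3)).
  { intros a Ha. unfold Rpower. auto_derive. auto. field. lra. }
  intro Hy. destruct (Rlt_dec 0 y).
  - apply is_derive_ext_loc with (fun t => Rpower t (1/3)).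
    + exists (mkposreal y r). intros t Ht. change (Rabs (t - y) < y) in Ht.
      apply Rabs_def2 in Ht. unfold cbrt. destruct (Rlt_dec 0 t); lra.
    + unfold cbrt. destruct (Rlt_dec 0 y); [|lra]. now apply H.
  - assert (Hn : 0 < - y) by lra.
    apply is_derive_ext_loc with (fun t => - Rpower (- t) (1/3)).
    + exists (mkposreal (- y) Hn). intros t Ht. change (Rabs (t - y) < - y) in Ht.
      apply Rabs_def2 in Ht. unfold cbrt.
      destruct (Rlt_dec 0 t); [lra|]. destruct (Rlt_dec t 0); lra.
    + unfold cbrt. destruct (Rlt_dec 0 y); [lra|]. destruct (Rlt_dec y 0); [|lra].
      unfold Rpower. auto_derive. auto. field. lra.
Qed.

(** The closed form is [(-1)^n n!], so [inv_fam] lists the successive derivatives of the reciprocal,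
    as [gen_comp] demands. *)
Fixpoint inv_coef (n : nat) : R :=
  match n with O => 1 | S n => - INR (S n) * inv_coef n end.

Definition inv_fam (n : nat) (t : R) : R := inv_coef n * (/ t) ^ S n.

Lemma is_derive_inv_pow n t : t <> 0 ->
  is_derive (fun t => (/ t) ^ n) t (- INR n * (/ t) ^ S n).
Proof.
  intro H. auto_derive; auto.
  destruct n; [simpl; field; auto|]. rewrite Nat.pred_succ.
  cbn [pow]. rewrite S_INR. field. auto.
Qed.

Lemma inv_fam_derive n t : t <> 0 -> is_derive (inv_fam n) t (inv_fam (S n) t).
Proof.
  intro H. unfold inv_fam.
  replace (inv_coef (S n) * (/ t) ^ S (S n)) with
    (inv_coef n * (- INR (S n) * (/ t) ^ S (S n)))
    by (cbn [inv_coef]; ring).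
  apply is_derive_scal. now apply is_derive_inv_pow.
Qed.

(** The falling factorial [(1/3)(1/3 - 1)...(1/3 - n + 1)], which makes [cbrt_fam] the list of
    successive derivatives of the cube root away from 0. *)
Fixpoint cbrt_coef (n : nat) : R :=
  match n with O => 1 | S n => (1/3 - INR n) * cbrt_coef n end.

Definition cbrt_fam (n : nat) (t : R) : R := cbrt_coef n * (cbrt t * (/ t) ^ n).

Lemma cbrt_fam_derive n t : t <> 0 -> is_derive (cbrt_fam n) t (cbrt_fam (S n) t).
Proof.
  intro H. unfold cbrt_fam.
  replace (cbrt_coef (S n) * (cbrt t * (/ t) ^ S n)) with
    (cbrt_coef n * ((cbrt t * / t / 3) * (/ t) ^ n + cbrt t * (- INR n * (/ t) ^ S n)))
    by (cbn [cbrt_coef pow]; field; auto).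
  apply is_derive_scal.
  apply (is_derive_mult cbrt (fun t => (/ t) ^ n) t); [| | apply Rmult_comm].
  now apply is_derive_cbrt. now apply is_derive_inv_pow.
Qed.

Section Closure.
Variable W : set4.
Hypothesis HW : open4 W.

Lemma smooth4_const c : smooth4 W (fun _ _ _ _ => c).
Proof. apply smooth4_gen; auto. apply gen_const. Qed.

Lemma smooth4_coord d : smooth4 W (coord d).
Proof. apply smooth4_gen; auto. apply gen_coord. Qed.

Lemma smooth4_plus F G : smooth4 W F -> smooth4 W G ->
  smooth4 W (fun x u p q => F x u p q + G x u p q).
Proof. intros. apply smooth4_gen; auto. apply gen_plus; now apply gen_smooth. Qed.

Lemma smooth4_mult F G : smooth4 W F -> smooth4 W G ->
  smooth4 W (fun x u p q => F x u p q * G x u p q).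
Proof. intros. apply smooth4_gen; auto. apply gen_mult; now apply gen_smooth. Qed.

Lemma smooth4_comp (h : nat -> R -> R) (S : R -> Prop) n F :
  (forall n t, S t -> is_derive (h n) t (h (Datatypes.S n) t)) ->
  smooth4 W F -> (forall x u p q, W x u p q -> S (F x u p q)) ->
  smooth4 W (fun x u p q => h n (F x u p q)).
Proof.
  intros Hh HF HS. apply smooth4_gen; auto.
  apply (gen_comp W h S); auto. now apply gen_smooth.
Qed.

Lemma smooth4_inv F : smooth4 W F -> (forall x u p q, W x u p q -> F x u p q <> 0) ->
  smooth4 W (fun x u p q => / F x u p q).
Proof.
  intros HF H0. apply smooth4_eq_on with (fun x u p q => inv_fam 0 (F x u p q)); auto.
  - intros x u p q Hw. unfold inv_fam. simpl. ring.
  - apply smooth4_comp with (fun t => t <> 0); auto. apply inv_fam_derive.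
Qed.

Lemma smooth4_cbrt F : smooth4 W F -> (forall x u p q, W x u p q -> F x u p q <> 0) ->
  smooth4 W (fun x u p q => cbrt (F x u p q)).
Proof.
  intros HF H0. apply smooth4_eq_on with (fun x u p q => cbrt_fam 0 (F x u p q)); auto.
  - intros x u p q Hw. unfold cbrt_fam. simpl. ring.
  - apply smooth4_comp with (fun t => t <> 0); auto. apply cbrt_fam_derive.
Qed.

Lemma smooth4_exp F : smooth4 W F -> smooth4 W (fun x u p q => exp (F x u p q)).
Proof.
  intro HF. apply smooth4_comp with (h := fun _ => exp) (n := O) (S := fun _ => True); auto.
  intros. apply is_derive_exp.
Qed.

End Closure.

(** * Symmetry of mixed partial derivatives *)

Lemma schwarz_ball (g g1 g2 g12 g21 : R -> R -> R) a b r : 0 < r ->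
  (forall s t, Rabs (s - a) < r -> Rabs (t - b) < r ->
     is_derive (fun z => g z t) s (g1 s t) /\
     is_derive (fun z => g s z) t (g2 s t) /\
     is_derive (fun z => g2 z t) s (g12 s t) /\
     is_derive (fun z => g1 s z) t (g21 s t)) ->
  continuity_2d_pt g12 a b -> continuity_2d_pt g21 a b -> g12 a b = g21 a b.
Proof.
  intros Hr H C1 C2.
  assert (Z : forall y, Rabs (y - y) < r) by (intro; rewrite Rminus_diag, Rabs_R0; auto).
  assert (N : forall y s, Rabs (s - y) < r -> locally s (fun z => Rabs (z - y) < r)).
  { intros y s Hs. assert (P : 0 < r - Rabs (s - y)) by lra.
    exists (mkposreal _ P). intros z Hz. change (Rabs (z - s) < r - Rabs (s - y)) in Hz.
    replace (z - y) with ((z - s) + (s - y)) by ring.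
    eapply Rle_lt_trans. apply Rabs_triang. lra. }
  assert (E12 : forall s t, Rabs (s - a) < r -> Rabs (t - b) < r ->
    is_derive (fun z => Derive (fun t => g z t) t) s (g12 s t)).
  { intros s t Hs Ht. apply is_derive_ext_loc with (fun z => g2 z t); [|apply H; auto].
    generalize (N a s Hs). apply filter_imp. intros z Hz.
    symmetry. apply is_derive_unique, H; auto. }
  assert (E21 : forall s t, Rabs (s - a) < r -> Rabs (t - b) < r ->
    is_derive (fun z => Derive (fun t => g t z) s) t (g21 s t)).
  { intros s t Hs Ht. apply is_derive_ext_loc with (fun z => g1 s z); [|apply H; auto].
    generalize (N b t Ht). apply filter_imp. intros z Hz.
    symmetry. apply is_derive_unique, H; auto. }
  rewrite <- (is_derive_unique _ _ _ (E12 a b (Z a) (Z b))).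
  rewrite <- (is_derive_unique _ _ _ (E21 a b (Z a) (Z b))).
  apply Schwarz.
  - exists (mkposreal r Hr). simpl. intros s t Hs Ht.
    destruct (H s t Hs Ht) as [h1 [h2 _]].
    repeat split; eexists; eauto.
  - apply continuity_2d_pt_ext_loc with g12; auto.
    exists (mkposreal r Hr). simpl. intros s t Hs Ht.
    symmetry. now apply is_derive_unique, E12.
  - apply continuity_2d_pt_ext_loc with g21; auto.
    exists (mkposreal r Hr). simpl. intros s t Hs Ht.
    symmetry. now apply is_derive_unique, E21.
Qed.

Definition place (d e : dir4) (F : fun4) (x u p q : R) : R -> R -> R :=
  match d, e with
  | Dx, Du => fun s t => F s t p q
  | Dx, Dp => fun s t => F s u t q
  | Dx, Dq => fun s t => F s u p t
  | Du, Dx => fun s t => F t s p q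
  | Du, Dp => fun s t => F x s t q
  | Du, Dq => fun s t => F x s p t
  | Dp, Dx => fun s t => F t u s q
  | Dp, Du => fun s t => F x t s q
  | Dp, Dq => fun s t => F x u s t
  | Dq, Dx => fun s t => F t u p s
  | Dq, Du => fun s t => F x t p s
  | Dq, Dp => fun s t => F x u t s
  | _, _ => fun _ _ => F x u p q
  end.

Lemma cont4_place d e F x u p q : cont4 F x u p q ->
  continuity_2d_pt (place d e F x u p q) (coord d x u p q) (coord e x u p q).
Proof.
  intros H eps. destruct (H eps (cond_pos eps)) as [r [Hr Hb]].
  assert (Z : forall y, Rabs (y - y) < r) by (intro; rewrite Rminus_diag, Rabs_R0; auto).
  exists (mkposreal r Hr). simpl. intros s t Hs Ht.
  destruct d, e; simpl in *; auto.
Qed.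

Lemma smooth4_schwarz W F d e : open4 W -> smooth4 W F ->
  eq_on W (pd d (pd e F)) (pd e (pd d F)).
Proof.
  intros HW HF x u p q Hw.
  assert (D : d = e \/ d <> e) by (destruct d, e; (now left) || (right; discriminate)).
  destruct D as [->|D]; [reflexivity|].
  assert (C : forall a b, cont4 (pd a (pd b F)) x u p q).
  { intros. now apply (smooth4_cont W), Hw; repeat apply smooth4_pd. }
  destruct (HW _ _ _ _ Hw) as [r [Hr Hb]].
  assert (Z : forall y, Rabs (y - y) < r) by (intro; rewrite Rminus_diag, Rabs_R0; auto).
  assert (I : forall a G, smooth4 W G -> forall x' u' p' q',
     Rabs (x' - x) < r -> Rabs (u' - u) < r -> Rabs (p' - p) < r -> Rabs (q' - q) < r ->
     is_pd a G x' u' p' q' (pd a G x' u' p' q')).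
  { intros. apply (smooth4_is_pd W); auto. }
  pose proof (fun a => smooth4_pd W F a HF) as HF'.
  generalize (schwarz_ball (place d e F x u p q)
    (place d e (pd d F) x u p q) (place d e (pd e F) x u p q)
    (place d e (pd d (pd e F)) x u p q) (place d e (pd e (pd d F)) x u p q)
    (coord d x u p q) (coord e x u p q) r Hr).
  intro S. cut (place d e (pd d (pd e F)) x u p q (coord d x u p q) (coord e x u p q)
    = place d e (pd e (pd d F)) x u p q (coord d x u p q) (coord e x u p q)).
  { destruct d, e; simpl; auto. }
  apply S; [| now apply cont4_place | now apply cont4_place].
  intros s t Hs Ht. pose proof (I d F HF) as I1. pose proof (I e F HF) as I2.
  pose proof (I d _ (HF' e)) as I3. pose proof (I e _ (HF' d)) as I4.
  destruct d, e; try congruence; simpl in *;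
  (split; [apply I1; auto | split; [apply I2; auto | split; [apply I3; auto | apply I4; auto]]]).
Qed.

(** * Integration on boxes *)

Definition box (x0 u0 p0 q0 r : R) : set4 := fun x u p q =>
  Rabs (x - x0) < r /\ Rabs (u - u0) < r /\ Rabs (p - p0) < r /\ Rabs (q - q0) < r.

Lemma ball_shrink y s r : Rabs (s - y) < r ->
  exists e, 0 < e /\ forall z, Rabs (z - s) < e -> Rabs (z - y) < r.
Proof.
  intro H. exists (r - Rabs (s - y)). split. lra. intros z Hz.
  replace (z - y) with ((z - s) + (s - y)) by ring.
  eapply Rle_lt_trans. apply Rabs_triang. lra.
Qed.

Ltac split_Rmin := repeat match goal with
  | h : _ < Rmin _ _ |- _ => apply Rmin_Rgt in h; destruct h
  | h : Rmin _ _ > _ |- _ => apply Rmin_Rgt in h; destruct h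
  end.

Lemma open4_box x0 u0 p0 q0 r : open4 (box x0 u0 p0 q0 r).
Proof.
  intros x u p q [H1 [H2 [H3 H4]]].
  destruct (ball_shrink _ _ _ H1) as [a [Ha Ba]], (ball_shrink _ _ _ H2) as [b [Hb Bb]],
    (ball_shrink _ _ _ H3) as [c [Hc Bc]], (ball_shrink _ _ _ H4) as [d [Hd Bd]].
  exists (Rmin (Rmin a b) (Rmin c d)). split. repeat apply Rmin_pos; auto.
  intros x' u' p' q' h1 h2 h3 h4.
  split_Rmin.
  unfold box. auto 10.
Qed.

Lemma between_ball c a b r t : Rabs (a - c) < r -> Rabs (b - c) < r ->
  Rmin a b <= t <= Rmax a b -> Rabs (t - c) < r.
Proof.
  intros Ha Hb Ht. apply Rabs_def2 in Ha. apply Rabs_def2 in Hb.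
  apply Rabs_def1; revert Ht; unfold Rmin, Rmax; destruct (Rle_dec a b); lra.
Qed.

Lemma lipschitz_interval (g g' : R -> R) a b M :
  (forall t, Rmin a b <= t <= Rmax a b -> is_derive g t (g' t) /\ Rabs (g' t) <= M) ->
  Rabs (g b - g a) <= M * Rabs (b - a).
Proof.
  intro H. destruct (MVT_gen g a b g') as [t [Ht E]].
  - intros x Hx. apply H. lra.
  - intros x Hx. apply derivable_continuous_pt, ex_derive_Reals_0.
    eexists. now apply H.
  - rewrite E, Rabs_mult. apply Rmult_le_compat_r. apply Rabs_pos. now apply H.
Qed.

(** The path from the centre along the coordinate axes stays in the box; the mean value theorem is
    applied on each of its four segments. *)
Lemma lipschitz_box F (A : dir4 -> fun4) x0 u0 p0 q0 r M :
  (forall x u p q, box x0 u0 p0 q0 r x u p q ->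
     forall d, is_pd d F x u p q (A d x u p q) /\ Rabs (A d x u p q) <= M) ->
  forall x u p q, box x0 u0 p0 q0 r x u p q ->
  Rabs (F x u p q - F x0 u0 p0 q0) <=
    M * (Rabs (x - x0) + Rabs (u - u0) + Rabs (p - p0) + Rabs (q - q0)).
Proof.
  intros H x u p q [H1 [H2 [H3 H4]]].
  assert (Z : forall y, Rabs (y - y) < r).
  { intro. rewrite Rminus_diag, Rabs_R0. pose proof (Rabs_pos (x - x0)). lra. }
  assert (Sx : Rabs (F x u0 p0 q0 - F x0 u0 p0 q0) <= M * Rabs (x - x0)).
  { apply (lipschitz_interval (fun t => F t u0 p0 q0) (fun t => A Dx t u0 p0 q0)).
    intros t Ht. refine (H t u0 p0 q0 _ Dx). repeat split; auto.
    exact (between_ball _ _ _ _ _ (Z _) H1 Ht). }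
  assert (Su : Rabs (F x u p0 q0 - F x u0 p0 q0) <= M * Rabs (u - u0)).
  { apply (lipschitz_interval (fun t => F x t p0 q0) (fun t => A Du x t p0 q0)).
    intros t Ht. refine (H x t p0 q0 _ Du). repeat split; auto.
    exact (between_ball _ _ _ _ _ (Z _) H2 Ht). }
  assert (Sp : Rabs (F x u p q0 - F x u p0 q0) <= M * Rabs (p - p0)).
  { apply (lipschitz_interval (fun t => F x u t q0) (fun t => A Dp x u t q0)).
    intros t Ht. refine (H x u t q0 _ Dp). repeat split; auto.
    exact (between_ball _ _ _ _ _ (Z _) H3 Ht). }
  assert (Sq : Rabs (F x u p q - F x u p q0) <= M * Rabs (q - q0)).
  { apply (lipschitz_interval (fun t => F x u p t) (fun t => A Dq x u p t)).
    intros t Ht. refine (H x u p t _ Dq). repeat split; auto.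
    exact (between_ball _ _ _ _ _ (Z _) H4 Ht). }
  replace (F x u p q - F x0 u0 p0 q0) with
    ((F x u0 p0 q0 - F x0 u0 p0 q0) + (F x u p0 q0 - F x u0 p0 q0) +
     ((F x u p q0 - F x u p0 q0) + (F x u p q - F x u p q0))) by ring.
  eapply Rle_trans. apply Rabs_triang.
  eapply Rle_trans. apply Rplus_le_compat; apply Rabs_triang. lra.
Qed.

(** Partial derivatives alone do not give the joint continuity that [smooth4] demands; continuity of
    the gradient bounds it locally and yields a Lipschitz estimate. *)
Lemma cont4_of_grad W F (A : dir4 -> fun4) : open4 W ->
  (forall d x u p q, W x u p q -> is_pd d F x u p q (A d x u p q)) ->
  (forall d x u p q, W x u p q -> cont4 (A d) x u p q) ->
  forall x u p q, W x u p q -> cont4 F x u p q.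
Proof.
  intros HW HF HA x u p q Hw e He.
  destruct (HW _ _ _ _ Hw) as [r0 [Hr0 B0]].
  assert (Bd : forall d, exists r, 0 < r /\ forall x' u' p' q',
    box x u p q r x' u' p' q' -> Rabs (A d x' u' p' q') <= Rabs (A d x u p q) + 1).
  { intro d. destruct (HA d _ _ _ _ Hw 1 Rlt_0_1) as [r [Hr B]].
    exists r. split; auto. intros x' u' p' q' [h1 [h2 [h3 h4]]].
    specialize (B _ _ _ _ h1 h2 h3 h4).
    pose proof (Rabs_triang (A d x' u' p' q' - A d x u p q) (A d x u p q)) as T.
    replace (A d x' u' p' q' - A d x u p q + A d x u p q) with (A d x' u' p' q') in T by ring.
    lra. }
  destruct (Bd Dx) as [r1 [Hr1 B1]], (Bd Du) as [r2 [Hr2 B2]],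
    (Bd Dp) as [r3 [Hr3 B3]], (Bd Dq) as [r4 [Hr4 B4]]. clear Bd.
  set (M := Rabs (A Dx x u p q) + Rabs (A Du x u p q) + Rabs (A Dp x u p q)
            + Rabs (A Dq x u p q) + 1).
  assert (HM : 0 < M).
  { unfold M. pose proof (Rabs_pos (A Dx x u p q)). pose proof (Rabs_pos (A Du x u p q)).
    pose proof (Rabs_pos (A Dp x u p q)). pose proof (Rabs_pos (A Dq x u p q)). lra. }
  set (r := Rmin r0 (Rmin (Rmin r1 r2) (Rmin r3 r4))).
  assert (Hr : 0 < r) by (unfold r; repeat apply Rmin_pos; auto).
  (* Four coordinate increments, each weighted by [M], must add up to less than [e]. *)
  exists (Rmin r (e / (4 * M))). split.
  { apply Rmin_pos; auto. apply Rdiv_lt_0_compat; lra. }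
  assert (L := lipschitz_box F A x u p q r M).
  intros x' u' p' q' h1 h2 h3 h4.
  apply Rmin_Rgt in h1. apply Rmin_Rgt in h2. apply Rmin_Rgt in h3. apply Rmin_Rgt in h4.
  eapply Rle_lt_trans. apply L.
  - clear - B0 B1 B2 B3 B4 HF HA.
    intros x' u' p' q' [h1 [h2 [h3 h4]]] d. unfold r in *.
    split_Rmin.
    split. apply HF, B0; auto.
    pose proof (Rabs_pos (A Dx x u p q)). pose proof (Rabs_pos (A Du x u p q)).
    pose proof (Rabs_pos (A Dp x u p q)). pose proof (Rabs_pos (A Dq x u p q)).
    assert (X : Rabs (A d x' u' p' q') <= Rabs (A d x u p q) + 1)
      by (destruct d; [apply B1 | apply B2 | apply B3 | apply B4]; repeat split; auto).
    unfold M. destruct d; lra.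
  - repeat split; tauto.
  - replace e with (M * (4 * (e / (4 * M)))) by (field; lra).
    apply Rmult_lt_compat_l; lra.
Qed.

(** The coinductive class is [F] together with all smooth functions: one differentiation leads from
    the former into the latter. *)
Lemma smooth4_of_grad W F (A : dir4 -> fun4) : open4 W ->
  (forall d x u p q, W x u p q -> is_pd d F x u p q (A d x u p q)) ->
  (forall d, smooth4 W (A d)) -> smooth4 W F.
Proof.
  intros HW HF HA.
  apply (smooth4_coind W (fun G => G = F \/ smooth4 W G)); auto.
  - intros G x u p q [->|HG] Hw; split.
    + apply (cont4_of_grad W F A); auto. intros. now apply (smooth4_cont W).
    + intro d. eapply is_pd_ex. now apply HF.
    + now apply (smooth4_cont W).
    + intro d. now apply (smooth4_ex_pd W).
  - intros G d [->|HG].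
    + exists (A d). split; auto. intros x u p q Hw. now apply is_pd_pd, HF.
    + exists (pd d G). split. right. now apply smooth4_pd. intros x u p q _. reflexivity.
Qed.

Lemma const_of_grad x0 u0 p0 q0 r F :
  (forall d x u p q, box x0 u0 p0 q0 r x u p q -> is_pd d F x u p q 0) ->
  forall x u p q, box x0 u0 p0 q0 r x u p q -> F x u p q = F x0 u0 p0 q0.
Proof.
  intros H x u p q Hb.
  pose proof (lipschitz_box F (fun _ _ _ _ _ => 0) x0 u0 p0 q0 r 0) as L.
  assert (E : Rabs (F x u p q - F x0 u0 p0 q0) <= 0).
  { eapply Rle_trans. apply L; auto.
    intros. split; auto. rewrite Rabs_R0. lra. lra. }
  pose proof (Rabs_pos (F x u p q - F x0 u0 p0 q0)).
  apply Rminus_diag_uniq. apply Rabs_eq_0. lra.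
Qed.

Lemma continuous_RInt_ball (g : R -> R) c r : (forall t, Rabs (t - c) < r -> continuous g t) ->
  forall s, Rabs (s - c) < r -> ex_RInt g c s.
Proof.
  intros H s Hs. apply (ex_RInt_continuous (V := R_CompleteNormedModule)).
  intros t Ht. apply H. apply (between_ball c c s); auto.
  rewrite Rminus_diag, Rabs_R0. pose proof (Rabs_pos (s - c)). lra.
Qed.

Lemma ball_locally c r s : Rabs (s - c) < r -> locally s (fun t => Rabs (t - c) < r).
Proof.
  intro H. destruct (ball_shrink _ _ _ H) as [e [He B]].
  exists (mkposreal e He). intros t Ht. apply B. exact Ht.
Qed.

Lemma is_derive_RInt_upper (g : R -> R) c r s :
  (forall t, Rabs (t - c) < r -> continuous g t) -> Rabs (s - c) < r ->
  is_derive (fun y => RInt g c y) s (g s).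
Proof.
  intros H Hs. apply (is_derive_RInt (V := R_NormedModule) g (fun y => RInt g c y) c s); auto.
  generalize (ball_locally c r s Hs). apply filter_imp. intros y Hy.
  apply (RInt_correct (V := R_CompleteNormedModule)). now apply (continuous_RInt_ball g c r).
Qed.

(** The step of the Poincare lemma that uses closedness: the [y]-derivative of [g] is also the
    [t]-derivative of [h], so differentiating under the integral leaves only boundary terms of
    [h]. *)
Lemma is_derive_RInt_closed (g h k : R -> R -> R) a c r s y : Rabs (y - a) < r ->
  Rabs (s - c) < r ->
  (forall y t, Rabs (y - a) < r -> Rabs (t - c) < r ->
     is_derive (fun y => g y t) y (k y t) /\ is_derive (fun t => h y t) t (k y t)
     /\ continuous (g y) t /\ continuity_2d_pt k y t) ->
  is_derive (fun y => RInt (g y) c s) y (h y s - h y c).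
Proof.
  intros Hy Hs H.
  assert (Hc : Rabs (c - c) < r).
  { rewrite Rminus_diag, Rabs_R0. pose proof (Rabs_pos (s - c)). lra. }
  assert (Hk : forall y t, Rabs (y - a) < r -> Rabs (t - c) < r ->
     Derive (fun y => g y t) y = k y t).
  { intros. now apply is_derive_unique, H. }
  assert (Hk' : forall t, Rabs (t - c) < r -> continuous (k y) t).
  { intros t Ht. destruct (H y t Hy Ht) as [_ [_ [_ C]]].
    apply continuity_pt_filterlim. intros e He. destruct (C (mkposreal e He)) as [d Hd].
    exists d. split. apply cond_pos. intros z [_ Hz]. apply Hd; auto.
    rewrite Rminus_diag, Rabs_R0. apply cond_pos. }
  replace (h y s - h y c) with (RInt (fun t => Derive (fun y => g y t) y) c s).
  - apply is_derive_RInt_param.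
    + generalize (ball_locally a r y Hy). apply filter_imp. intros z Hz t Ht.
      exists (k z t). apply (H z t Hz). now apply (between_ball c c s).
    + intros t Ht. assert (Ht' : Rabs (t - c) < r) by now apply (between_ball c c s).
      apply continuity_2d_pt_ext_loc with k; [|exact (proj2 (proj2 (proj2 (H y t Hy Ht'))))].
      destruct (ball_shrink _ _ _ Hy) as [e1 [He1 B1]], (ball_shrink _ _ _ Ht') as [e2 [He2 B2]].
      assert (P : 0 < Rmin e1 e2) by now apply Rmin_pos.
      exists (mkposreal _ P). simpl. intros z w Hz Hw.
      apply Rmin_Rgt in Hz. apply Rmin_Rgt in Hw.
      symmetry. apply Hk; [apply B1 | apply B2]; tauto.
    + generalize (ball_locally a r y Hy). apply filter_imp. intros z Hz.
      apply (continuous_RInt_ball (g z) c r); auto. intros. now apply H.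
  - rewrite (RInt_ext (V := R_CompleteNormedModule) _ (k y)).
    + apply is_RInt_unique. apply (is_RInt_derive (V := R_CompleteNormedModule) (h y) (k y)).
      * intros t Ht. apply H; auto. now apply (between_ball c c s).
      * intros t Ht. apply Hk'. now apply (between_ball c c s).
    + intros t Ht. apply Hk; auto. apply (between_ball c c s); auto. lra.
Qed.

(** * The ring of smooth functions on an open set *)

Record domain := { dom :> R -> R -> R -> R -> Prop; dom_open : open4 dom }.

(** Smooth functions on [W], extended by [0] so that equality on [W] is Leibniz equality. *)
Record sm (W : domain) := {
  ev :> R -> R -> R -> R -> R;
  ev_smooth : smooth4 W ev;
  ev_out : forall x u p q, ~ W x u p q -> ev x u p q = 0 }.

Record pt (W : domain) := Pt {
  px : R; pu : R; pp : R; pq : R; pt_in : W px pu pp pq }.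
Arguments px {W}. Arguments pu {W}. Arguments pp {W}. Arguments pq {W}.
Arguments pt_in {W}.
Arguments ev {W}. Arguments ev_smooth {W}. Arguments ev_out {W}.

Definition val {W} (F : sm W) (w : pt W) : R := ev F (px w) (pu w) (pp w) (pq w).

Lemma sm_ext W (F G : sm W) : (forall w, val F w = val G w) -> F = G.
Proof.
  destruct F as [F HF OF], G as [G HG OG]. unfold val. simpl. intro H.
  assert (F = G) as <-.
  { do 4 (apply functional_extensionality; intro).
    match goal with |- F ?x ?u ?p ?q = _ =>
      destruct (excluded_middle_informative (W x u p q)) as [h|h];
      [apply (H (Pt W x u p q h)) | now rewrite OF, OG] end. }
  f_equal; apply proof_irrelevance.
Qed.

Section Lift.
Context {W : domain}.

Definition cut_off (F : fun4) : fun4 := fun x u p q =>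
  if excluded_middle_informative (W x u p q) then F x u p q else 0.

Lemma cut_off_eq F : eq_on W (cut_off F) F.
Proof.
  intros x u p q h. unfold cut_off.
  destruct (excluded_middle_informative (W x u p q)); tauto.
Qed.

Definition lift (F : fun4) (H : smooth4 W F) : sm W.
Proof.
  exists (cut_off F).
  - apply smooth4_eq_on with F; auto. apply dom_open. apply eq_on_sym, cut_off_eq.
  - intros x u p q h. unfold cut_off.
    destruct (excluded_middle_informative (W x u p q)); tauto.
Defined.

Lemma lift_eq F H : eq_on W (lift F H) F.
Proof. apply cut_off_eq. Qed.

Lemma val_lift F H w : val (lift F H) w = F (px w) (pu w) (pp w) (pq w).
Proof. apply lift_eq, pt_in. Qed.

Definition sm_const (c : R) : sm W := lift _ (smooth4_const W (dom_open W) c).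
Definition sm_coord d : sm W := lift _ (smooth4_coord W (dom_open W) d).
Definition sm_add (F G : sm W) : sm W :=
  lift _ (smooth4_plus W (dom_open W) F G (ev_smooth F) (ev_smooth G)).
Definition sm_mul (F G : sm W) : sm W :=
  lift _ (smooth4_mult W (dom_open W) F G (ev_smooth F) (ev_smooth G)).
Definition sm_opp (F : sm W) := sm_mul (sm_const (-1)) F.
Definition sm_sub (F G : sm W) := sm_add F (sm_opp G).
Definition der d (F : sm W) : sm W := lift _ (smooth4_pd W F d (ev_smooth F)).

Definition unit (F : sm W) := forall w, val F w <> 0.

Lemma unit_ev F : unit F -> forall x u p q, W x u p q -> F x u p q <> 0.
Proof. intros H x u p q h. apply (H (Pt W x u p q h)). Qed.

(** Totalised by 0, so that inversion is an operation of the ring; its laws are stated for units,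
    the functions without zeros on [W]. *)
Definition sm_inv (F : sm W) : sm W :=
  match excluded_middle_informative (unit F) with
  | left H => lift _ (smooth4_inv W (dom_open W) F (ev_smooth F) (unit_ev F H))
  | right _ => sm_const 0
  end.

Definition sm_cbrt (F : sm W) : sm W :=
  match excluded_middle_informative (unit F) with
  | left H => lift _ (smooth4_cbrt W (dom_open W) F (ev_smooth F) (unit_ev F H))
  | right _ => sm_const 0
  end.

Lemma val_const c w : val (sm_const c) w = c.
Proof. unfold sm_const. now rewrite val_lift. Qed.
Lemma val_add F G w : val (sm_add F G) w = val F w + val G w.
Proof. unfold sm_add. now rewrite val_lift. Qed.
Lemma val_mul F G w : val (sm_mul F G) w = val F w * val G w.
Proof. unfold sm_mul. now rewrite val_lift. Qed.
Lemma val_opp F w : val (sm_opp F) w = - val F w.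
Proof. unfold sm_opp. rewrite val_mul, val_const. ring. Qed.
Lemma val_sub F G w : val (sm_sub F G) w = val F w - val G w.
Proof. unfold sm_sub. rewrite val_add, val_opp. ring. Qed.
Lemma val_inv F w : unit F -> val (sm_inv F) w = / val F w.
Proof.
  intro H. unfold sm_inv. destruct (excluded_middle_informative (unit F)); [|tauto].
  now rewrite val_lift.
Qed.
Lemma val_cbrt F w : unit F -> val (sm_cbrt F) w = cbrt (val F w).
Proof.
  intro H. unfold sm_cbrt. destruct (excluded_middle_informative (unit F)); [|tauto].
  now rewrite val_lift.
Qed.

Lemma val_der d F w : val (der d F) w = pd d F (px w) (pu w) (pp w) (pq w).
Proof. unfold der. now rewrite val_lift. Qed.

Lemma sm_is_pd d (F : sm W) w :
  is_pd d F (px w) (pu w) (pp w) (pq w) (val (der d F) w).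
Proof. rewrite val_der. apply (smooth4_is_pd W). apply ev_smooth. apply pt_in. Qed.

Lemma der_lift d F H w l : is_pd d F (px w) (pu w) (pp w) (pq w) l ->
  val (der d (lift F H)) w = l.
Proof.
  intro h. rewrite val_der. apply is_pd_pd.
  apply (is_pd_eq_on W F); auto using dom_open, pt_in.
  apply eq_on_sym, lift_eq.
Qed.

Lemma der_const d c : der d (sm_const c) = sm_const 0.
Proof.
  apply sm_ext. intro w. rewrite val_const. apply der_lift. apply is_pd_const.
Qed.

Lemma der_coord d e : der d (sm_coord e) = sm_const (if dir_eqb d e then 1 else 0).
Proof.
  apply sm_ext. intro w. rewrite val_const. apply der_lift. apply is_pd_coord.
Qed.

Lemma der_add d F G : der d (sm_add F G) = sm_add (der d F) (der d G).
Proof.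
  apply sm_ext. intro w. rewrite val_add. apply der_lift.
  apply is_pd_plus; apply sm_is_pd.
Qed.

Lemma der_mul d F G :
  der d (sm_mul F G) = sm_add (sm_mul (der d F) G) (sm_mul F (der d G)).
Proof.
  apply sm_ext. intro w. rewrite val_add, !val_mul. apply der_lift.
  apply is_pd_mult; apply sm_is_pd.
Qed.

Lemma der_opp d F : der d (sm_opp F) = sm_opp (der d F).
Proof.
  unfold sm_opp. rewrite der_mul, der_const. apply sm_ext. intro w.
  rewrite !val_add, !val_mul, !val_const. ring.
Qed.

Lemma der_sub d F G : der d (sm_sub F G) = sm_sub (der d F) (der d G).
Proof. unfold sm_sub. now rewrite der_add, der_opp. Qed.

(** Leibniz rule applied to [F * / F = 1], solved for the derivative of the inverse. *)
Lemma der_inv d F : unit F ->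
  der d (sm_inv F) = sm_opp (sm_mul (der d F) (sm_mul (sm_inv F) (sm_inv F))).
Proof.
  intro H. assert (E : sm_mul F (sm_inv F) = sm_const 1).
  { apply sm_ext. intro w. rewrite val_mul, (val_inv F w H), val_const.
    apply Rinv_r, H. }
  apply (f_equal (der d)) in E. rewrite der_mul, der_const in E.
  apply sm_ext. intro w. apply (f_equal (fun F => val F w)) in E.
  rewrite val_add, !val_mul, val_const, val_inv in E by auto.
  rewrite val_opp, !val_mul, !val_inv by auto.
  apply Rmult_eq_reg_l with (val F w); [|apply H].
  apply Rplus_eq_reg_l with (val (der d F) w * / val F w). rewrite E.
  field. apply H.
Qed.

Lemma der_comm d e F : der d (der e F) = der e (der d F).
Proof.
  assert (H : forall d e, eq_on W (der d (der e F)) (pd d (pd e F))).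
  { intros a b x u p q h. unfold der at 1. rewrite lift_eq by auto.
    apply (pd_eq_on W); [apply dom_open | apply lift_eq | exact h]. }
  apply sm_ext. intro w. unfold val. rewrite !H by apply pt_in.
  apply (smooth4_schwarz W); [apply dom_open | apply ev_smooth | apply pt_in].
Qed.

End Lift.
Arguments sm_const : clear implicits.
Arguments sm_coord : clear implicits.

Declare Scope sm_scope.
Delimit Scope sm_scope with sm.
Bind Scope sm_scope with sm.
Infix "+" := sm_add : sm_scope.
Infix "-" := sm_sub : sm_scope.
Infix "*" := sm_mul : sm_scope.
Notation "- F" := (sm_opp F) : sm_scope.
Notation "/ F" := (sm_inv F) : sm_scope.
Notation "# c" := (sm_const _ c%R) (at level 1, format "# c") : sm_scope.

#[export] Hint Rewrite @val_const @val_add @val_mul @val_opp @val_sub : val.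
#[export] Hint Rewrite @der_const @der_add @der_mul @der_opp @der_sub : der.

(** * The total derivative and its commutators with partial derivatives *)

Section Frame.
Context {W : domain} (f : sm W).
Local Open Scope sm_scope.

Definition Dt (F : sm W) : sm W :=
  der Dx F + sm_coord W Dp * der Du F + sm_coord W Dq * der Dp F + f * der Dq F.

Ltac byval := apply sm_ext; intro; autorewrite with val; ring.

Lemma Dt_const c : Dt #c = #0.
Proof. unfold Dt. rewrite !der_const. byval. Qed.
Lemma Dt_add F G : Dt (F + G) = Dt F + Dt G.
Proof. unfold Dt. rewrite !der_add. byval. Qed.
Lemma Dt_opp F : Dt (- F) = - Dt F.
Proof. unfold Dt. rewrite !der_opp. byval. Qed.
Lemma Dt_sub F G : Dt (F - G) = Dt F - Dt G.
Proof. unfold Dt. rewrite !der_sub. byval. Qed.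
Lemma Dt_mul F G : Dt (F * G) = Dt F * G + F * Dt G.
Proof. unfold Dt. rewrite !der_mul. byval. Qed.
Lemma Dt_inv F : unit F -> Dt (/ F) = - (Dt F * (/ F * / F)).
Proof. intro H. unfold Dt. rewrite !der_inv by auto. byval. Qed.

(** The commutators come from the coefficients [p], [q], [f] of the total derivative; with them the
    computations on invariants need no [x]-derivative. *)
Lemma der_Dt d F : der d (Dt F) = Dt (der d F) +
  (match d with Dx => #0 | Du => #0 | Dp => der Du F | Dq => der Dp F end)
  + der d f * der Dq F.
Proof.
  unfold Dt. rewrite !der_add, !der_mul, !der_coord.
  rewrite !(der_comm d). destruct d; simpl dir_eqb; cbv iota; byval.
Qed.

Lemma der_Dt_u F : der Du (Dt F) = Dt (der Du F) + der Du f * der Dq F.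
Proof. rewrite der_Dt. byval. Qed.
Lemma der_Dt_p F : der Dp (Dt F) = Dt (der Dp F) + der Du F + der Dp f * der Dq F.
Proof. apply der_Dt. Qed.
Lemma der_Dt_q F : der Dq (Dt F) = Dt (der Dq F) + der Dp F + der Dq f * der Dq F.
Proof. apply der_Dt. Qed.

End Frame.

#[export] Hint Rewrite @Dt_const @Dt_add @Dt_sub @Dt_mul @Dt_opp
  @der_Dt_u @der_Dt_p @der_Dt_q : der.

(** * The Poincare lemma on a box *)

Definition box_domain x0 u0 p0 q0 r : domain :=
  Build_domain (box x0 u0 p0 q0 r) (open4_box x0 u0 p0 q0 r).

Lemma continuous_slice d F x u p q : cont4 F x u p q ->
  continuous (slice d F x u p q) (coord d x u p q).
Proof.
  intro H. apply continuity_pt_filterlim. intros e He.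
  destruct (H e He) as [r [Hr B]]. exists r. split; auto.
  assert (Z : forall y, Rabs (y - y) < r) by (intro; rewrite Rminus_diag, Rabs_R0; auto).
  intros z [_ Hz]. simpl in Hz. unfold R_dist in *. simpl.
  rewrite slice_coord. destruct d; simpl in *; apply B; auto.
Qed.

Lemma poincare x0 u0 p0 q0 r (a : dir4 -> sm (box_domain x0 u0 p0 q0 r)) :
  (forall d e, der d (a e) = der e (a d)) ->
  exists F : sm (box_domain x0 u0 p0 q0 r), forall d, der d F = a d.
Proof.
  intro Hcl. destruct (Rlt_dec 0 r) as [Hr|Hr].
  2:{ exists (sm_const _ 0). intro d. apply sm_ext. intro w. exfalso.
      destruct w as [x u p q [h _]]. pose proof (Rabs_pos (x - x0)). lra. }
  set (B := box x0 u0 p0 q0 r).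
  (* The integral of the one-form along the broken path that moves [x], [u], [p], [q] in this
     order. *)
  set (F := fun x u p q =>
    RInt (fun t => a Dx t u0 p0 q0) x0 x + RInt (fun t => a Du x t p0 q0) u0 u
    + (RInt (fun t => a Dp x u t q0) p0 p + RInt (fun t => a Dq x u p t) q0 q)).
  assert (Z : forall y, Rabs (y - y) < r) by (intro; rewrite Rminus_diag, Rabs_R0; auto).
  assert (C : forall d x u p q, B x u p q -> cont4 (a d) x u p q).
  { intros d x u p q h. exact (smooth4_cont _ _ _ _ _ _ (ev_smooth (a d)) h). }
  assert (C' : forall e d x u p q, B x u p q -> cont4 (der e (a d)) x u p q).
  { intros e d x u p q h. exact (smooth4_cont _ _ _ _ _ _ (ev_smooth (der e (a d))) h). }
  assert (K : forall d e x u p q, B x u p q -> is_pd e (a d) x u p q (der e (a d) x u p q)).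
  { intros d e x u p q h. exact (sm_is_pd e (a d) (Pt (box_domain x0 u0 p0 q0 r) x u p q h)). }
  assert (K' : forall d e x u p q, B x u p q -> is_pd d (a e) x u p q (der e (a d) x u p q)).
  { intros d e x u p q h. rewrite (Hcl e d). now apply K. }
  (* In direction [d] the earlier legs are constant, the leg of [d] gives the integrand at its upper
     end, and closedness turns each later leg into a difference of values of [a d]; the sum
     telescopes. *)
  assert (D : forall d x u p q, B x u p q -> is_pd d F x u p q (a d x u p q)).
  { intros d x u p q [h1 [h2 [h3 h4]]].
    assert (Iu : forall x u p q, Rabs (x - x0) < r -> Rabs (u - u0) < r -> Rabs (p - p0) < r ->
       Rabs (q - q0) < r -> B x u p q) by (unfold B, box; auto).
    unfold is_pd, F. destruct d; simpl.
    - replace (a Dx x u p q) with (a Dx x u0 p0 q0 + (a Dx x u p0 q0 - a Dx x u0 p0 q0)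
        + ((a Dx x u p q0 - a Dx x u p0 q0) + (a Dx x u p q - a Dx x u p q0))) by ring.
      apply (is_derive_plus (V := R_NormedModule)); apply (is_derive_plus (V := R_NormedModule)).
      + apply (is_derive_RInt_upper (fun t => a Dx t u0 p0 q0) x0 r); auto.
        intros t Ht. apply (continuous_slice Dx (a Dx) t u0 p0 q0), C, Iu; auto.
      + apply (is_derive_RInt_closed (fun y t => a Du y t p0 q0) (fun y t => a Dx y t p0 q0)
          (fun y t => der Dx (a Du) y t p0 q0) x0 u0 r u x); auto.
        intros y t Hy Ht. assert (W := Iu y t p0 q0 Hy Ht (Z _) (Z _)). split; [|split; [|split]].
        apply (K Du Dx _ _ _ _ W). apply (K' Du Dx _ _ _ _ W).
        apply (continuous_slice Du (a Du) y t p0 q0), C, Iu; auto.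
        apply (cont4_place Dx Du _ y t p0 q0); exact (C' _ _ _ _ _ _ W).
      + apply (is_derive_RInt_closed (fun y t => a Dp y u t q0) (fun y t => a Dx y u t q0)
          (fun y t => der Dx (a Dp) y u t q0) x0 p0 r p x); auto.
        intros y t Hy Ht. assert (W := Iu y u t q0 Hy h2 Ht (Z _)). split; [|split; [|split]].
        apply (K Dp Dx _ _ _ _ W). apply (K' Dp Dx _ _ _ _ W).
        apply (continuous_slice Dp (a Dp) y u t q0), C, Iu; auto.
        apply (cont4_place Dx Dp _ y u t q0); exact (C' _ _ _ _ _ _ W).
      + apply (is_derive_RInt_closed (fun y t => a Dq y u p t) (fun y t => a Dx y u p t)
          (fun y t => der Dx (a Dq) y u p t) x0 q0 r q x); auto.
        intros y t Hy Ht. assert (W := Iu y u p t Hy h2 h3 Ht). split; [|split; [|split]].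
        apply (K Dq Dx _ _ _ _ W). apply (K' Dq Dx _ _ _ _ W).
        apply (continuous_slice Dq (a Dq) y u p t), C, Iu; auto.
        apply (cont4_place Dx Dq _ y u p t); exact (C' _ _ _ _ _ _ W).
    - replace (a Du x u p q) with (0 + a Du x u p0 q0
        + ((a Du x u p q0 - a Du x u p0 q0) + (a Du x u p q - a Du x u p q0))) by ring.
      apply (is_derive_plus (V := R_NormedModule)); apply (is_derive_plus (V := R_NormedModule)).
      + exact (is_derive_const (V := R_NormedModule) _ _).
      + apply (is_derive_RInt_upper (fun t => a Du x t p0 q0) u0 r); auto.
        intros t Ht. apply (continuous_slice Du (a Du) x t p0 q0), C, Iu; auto.
      + apply (is_derive_RInt_closed (fun y t => a Dp x y t q0) (fun y t => a Du x y t q0)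
          (fun y t => der Du (a Dp) x y t q0) u0 p0 r p u); auto.
        intros y t Hy Ht. assert (W := Iu x y t q0 h1 Hy Ht (Z _)). split; [|split; [|split]].
        apply (K Dp Du _ _ _ _ W). apply (K' Dp Du _ _ _ _ W).
        apply (continuous_slice Dp (a Dp) x y t q0), C, Iu; auto.
        apply (cont4_place Du Dp _ x y t q0); exact (C' _ _ _ _ _ _ W).
      + apply (is_derive_RInt_closed (fun y t => a Dq x y p t) (fun y t => a Du x y p t)
          (fun y t => der Du (a Dq) x y p t) u0 q0 r q u); auto.
        intros y t Hy Ht. assert (W := Iu x y p t h1 Hy h3 Ht). split; [|split; [|split]].
        apply (K Dq Du _ _ _ _ W). apply (K' Dq Du _ _ _ _ W).
        apply (continuous_slice Dq (a Dq) x y p t), C, Iu; auto.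
        apply (cont4_place Du Dq _ x y p t); exact (C' _ _ _ _ _ _ W).
    - replace (a Dp x u p q) with (0 + 0 +
        (a Dp x u p q0 + (a Dp x u p q - a Dp x u p q0))) by ring.
      apply (is_derive_plus (V := R_NormedModule)); apply (is_derive_plus (V := R_NormedModule)).
      + exact (is_derive_const (V := R_NormedModule) _ _).
      + exact (is_derive_const (V := R_NormedModule) _ _).
      + apply (is_derive_RInt_upper (fun t => a Dp x u t q0) p0 r); auto.
        intros t Ht. apply (continuous_slice Dp (a Dp) x u t q0), C, Iu; auto.
      + apply (is_derive_RInt_closed (fun y t => a Dq x u y t) (fun y t => a Dp x u y t)
          (fun y t => der Dp (a Dq) x u y t) p0 q0 r q p); auto.
        intros y t Hy Ht. assert (W := Iu x u y t h1 h2 Hy Ht). split; [|split; [|split]].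
        apply (K Dq Dp _ _ _ _ W). apply (K' Dq Dp _ _ _ _ W).
        apply (continuous_slice Dq (a Dq) x u y t), C, Iu; auto.
        apply (cont4_place Dp Dq _ x u y t); exact (C' _ _ _ _ _ _ W).
    - replace (a Dq x u p q) with (0 + 0 + (0 + a Dq x u p q)) by ring.
      apply (is_derive_plus (V := R_NormedModule)); apply (is_derive_plus (V := R_NormedModule)).
      + exact (is_derive_const (V := R_NormedModule) _ _).
      + exact (is_derive_const (V := R_NormedModule) _ _).
      + exact (is_derive_const (V := R_NormedModule) _ _).
      + apply (is_derive_RInt_upper (fun t => a Dq x u p t) q0 r); auto.
        intros t Ht. apply (continuous_slice Dq (a Dq) x u p t), C, Iu; auto. }
  assert (HF : smooth4 (box_domain x0 u0 p0 q0 r) F).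
  { apply (smooth4_of_grad _ F (fun d => a d)); [apply dom_open | exact D |].
    intro d. exact (ev_smooth (a d)). }
  exists (lift F HF). intro d. apply sm_ext. intro w. apply der_lift.
  exact (D d _ _ _ _ (pt_in w)).
Qed.

(** * The equation [v''' = s v' + v] *)

Section LinearODE.
Variable s : R.

(** Three consecutive derivatives at 0 of the solution with initial data [(0, 0, 1)]; carrying the
    triple makes the third-order recursion structural. *)
Fixpoint taylor3 (n : nat) : R * R * R :=
  match n with
  | O => (0, 0, 1)
  | S n => let '(a, b, c) := taylor3 n in (b, c, s * b + a)
  end.

Definition taylor (n : nat) : R := fst (fst (taylor3 n)).

Lemma taylor_rec n : taylor (S (S (S n))) = s * taylor (S n) + taylor n.
Proof. unfold taylor. cbn [taylor3]. destruct (taylor3 n) as [[a b] c]. reflexivity. Qed.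

(** With [M = 1 + |s| >= 1] the recursion gives at most [|s| M^(n+1) + M^n <= M^(n+2)]; as it spans
    three steps, three consecutive bounds are carried. *)
Lemma taylor_bound n : Rabs (taylor n) <= (1 + Rabs s) ^ n.
Proof.
  set (M := 1 + Rabs s). assert (HM : 1 <= M) by (unfold M; pose proof (Rabs_pos s); lra).
  cut (Rabs (taylor n) <= M ^ n /\ Rabs (taylor (S n)) <= M ^ S n
       /\ Rabs (taylor (S (S n))) <= M ^ S (S n)); [tauto|].
  induction n as [|n [H0 [H1 H2]]].
  - unfold taylor. simpl. rewrite Rabs_R0, Rabs_R1. repeat split; nra.
  - split; [|split]; auto. rewrite taylor_rec.
    eapply Rle_trans. apply Rabs_triang. rewrite Rabs_mult.
    pose proof (Rabs_pos s).
    assert (0 < M ^ n) by (apply pow_lt; lra).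
    assert (Rabs s * Rabs (taylor (S n)) <= Rabs s * M ^ S n)
      by (apply Rmult_le_compat_l; auto).
    assert (E : M ^ S (S (S n)) = M * (M * (M * M ^ n))) by (simpl; ring).
    cbn [pow] in *.
    assert (M ^ n <= M * M ^ n) by nra.
    assert (M * M ^ n <= M * (M * M ^ n)) by nra.
    assert (Hs : Rabs s = M - 1) by (unfold M; ring). rewrite Hs in *.
    nra.
Qed.

(** The [n]-th derivative of that solution, obtained by shifting Taylor coefficients; the family
    then has the form that [smooth4_comp] requires. *)
Definition ode_sol (n : nat) (t : R) : R :=
  PSeries (fun k => taylor (n + k) / INR (fact k)) t.

Lemma ode_sol_radius n x :
  Rbar_lt (Rabs x) (CV_radius (fun k => taylor (n + k) / INR (fact k))).
Proof.
  set (M := 1 + Rabs s). set (r := Rabs x + 1).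
  assert (HM : 0 < M) by (unfold M; pose proof (Rabs_pos s); lra).
  assert (Hr : 0 < r) by (unfold r; pose proof (Rabs_pos x); lra).
  apply Rbar_lt_le_trans with r; [unfold r; simpl; lra|].
  apply (CV_radius_bounded (fun k => taylor (n + k) / INR (fact k))).
  destruct (maj_by_pos (fun k => (M * r) ^ k / INR (fact k))) as [l [Hl B]].
  { exists 0. apply cv_speed_pow_fact. }
  exists (M ^ n * l). intro k.
  assert (F : 0 < INR (fact k)) by apply INR_fact_lt_0.
  pose proof (taylor_bound (n + k)) as T. fold M in T.
  apply Rle_trans with (M ^ n * Rabs ((M * r) ^ k / INR (fact k))).
  2:{ apply Rmult_le_compat_l; [apply pow_le; lra | apply B]. }
  rewrite Rpow_mult_distr. unfold Rdiv. rewrite !Rabs_mult.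
  rewrite (Rabs_pos_eq (M ^ k)), (Rabs_pos_eq (r ^ k)) by (apply pow_le; lra).
  rewrite pow_add in T.
  replace (M ^ n * (M ^ k * r ^ k * Rabs (/ INR (fact k)))) with
    (M ^ n * M ^ k * (Rabs (/ INR (fact k)) * r ^ k)) by ring.
  rewrite Rmult_assoc.
  apply Rmult_le_compat_r; auto.
  apply Rmult_le_pos; [apply Rabs_pos | apply pow_le; lra].
Qed.

Lemma ode_sol_derive n t : is_derive (ode_sol n) t (ode_sol (S n) t).
Proof.
  replace (ode_sol (S n) t) with
    (PSeries (PS_derive (fun k => taylor (n + k) / INR (fact k))) t).
  - apply is_derive_PSeries, ode_sol_radius.
  - apply PSeries_ext. intro k. unfold PS_derive.
    replace (n + S k)%nat with (S n + k)%nat by lia.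
    rewrite fact_simpl, mult_INR. field. split; [apply INR_fact_neq_0 | apply not_0_INR; lia].
Qed.

Lemma ode_sol_rec t : ode_sol 3 t = s * ode_sol 1 t + ode_sol 0 t.
Proof.
  unfold ode_sol. rewrite <- PSeries_scal, <- PSeries_plus.
  - apply PSeries_ext. intro k. unfold PS_plus, PS_scal, plus, scal. simpl.
    unfold mult. simpl. rewrite taylor_rec. field. apply INR_fact_neq_0.
  - apply ex_pseries_scal. intros; apply Rmult_comm.
    apply CV_radius_inside, (ode_sol_radius 1).
  - apply CV_radius_inside, (ode_sol_radius 0).
Qed.

Lemma ode_sol_0 n : ode_sol n 0 = taylor n.
Proof.
  unfold ode_sol. rewrite PSeries_0, Nat.add_0_r. simpl. field.
Qed.

End LinearODE.

(** The companion matrix of [v''' = s v' + v] is traceless, so its exponential,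
    whose entries appear here, has determinant 1. *)
Lemma ode_sol_det s t :
  let c := ode_sol s 0 t in let b := ode_sol s 1 t in
  let a := ode_sol s 2 t - s * c in
  a * ((a + s * c) * (a + s * c) - b * (c + s * b))
  - b * (c * (a + s * c) - b * b) + c * (c * (c + s * b) - (a + s * c) * b) = 1.
Proof.
  cbv zeta.
  set (F := fun t => let c := ode_sol s 0 t in let b := ode_sol s 1 t in
    let a := ode_sol s 2 t - s * c in
    a * ((a + s * c) * (a + s * c) - b * (c + s * b))
    - b * (c * (a + s * c) - b * b) + c * (c * (c + s * b) - (a + s * c) * b)).
  change (F t = 1).
  assert (E : F 0 = 1).
  { unfold F. cbv zeta. rewrite !ode_sol_0. unfold taylor. simpl. ring. }
  rewrite <- E.
  assert (D : forall t, is_derive F t 0).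
  { intro z. unfold F. cbv zeta.
    pose proof (ode_sol_derive s 0 z) as D0. pose proof (ode_sol_derive s 1 z) as D1.
    pose proof (ode_sol_derive s 2 z) as D2.
    assert (X0 := is_derive_unique _ _ _ D0). assert (X1 := is_derive_unique _ _ _ D1).
    assert (X2 := is_derive_unique _ _ _ D2).
    assert (ex_derive (ode_sol s 0) z) by (eexists; eauto).
    assert (ex_derive (ode_sol s 1) z) by (eexists; eauto).
    assert (ex_derive (ode_sol s 2) z) by (eexists; eauto).
    auto_derive. tauto.
    change (fun x : R => ode_sol s 0 x) with (ode_sol s 0).
    change (fun x : R => ode_sol s 1 x) with (ode_sol s 1).
    change (fun x : R => ode_sol s 2 x) with (ode_sol s 2).
    rewrite X0, X1, X2, (ode_sol_rec s z). ring. }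
  assert (L : (Rabs (F t - F 0) <= 0 * Rabs (t - 0))%R).
  { apply (lipschitz_interval F (fun _ => 0%R)). intros z _. split; auto.
    rewrite Rabs_R0. apply Rle_refl. }
  rewrite Rmult_0_l in L. pose proof (Rabs_pos (F t - F 0)).
  apply Rminus_diag_uniq. apply Rabs_eq_0. lra.
Qed.

(** * The relative invariants *)

Local Open Scope sm_scope.

Lemma unit_mul W (F G : sm W) : unit F -> unit G -> unit (F * G).
Proof.
  intros HF HG w. rewrite val_mul. apply Rmult_integral_contrapositive_currified; auto.
Qed.
Lemma unit_const W c : c <> 0%R -> unit (sm_const W c).
Proof. intros H w. now rewrite val_const. Qed.
Lemma unit_opp W (F : sm W) : unit F -> unit (- F).
Proof. intros H w. rewrite val_opp. apply Ropp_neq_0_compat, H. Qed.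
Lemma unit_inv W (F : sm W) : unit F -> unit (/ F).
Proof. intros H w. rewrite val_inv by auto. apply Rinv_neq_0_compat, H. Qed.
#[export] Hint Resolve unit_mul unit_opp unit_inv : unit.

Section Invariants.
Context {W : domain} (f : sm W).
Local Notation D := (Dt f).

(* [h1], ..., [h12], [hK] stand for [I1], ..., [I12], [K], with an arbitrary unit [j]
   in the place of [J3]. *)
Definition h1 : sm W := - der Dq f.
Definition h2 : sm W := #(-(2/9)) * (h1 * h1) - der Dp f - #(1/3) * D h1.
Definition h3 : sm W := #(-(1/3)) * h1 * h2 - der Du f - #(1/2) * D h2.

Variable j : sm W.
Definition h4 : sm W := der Dq j.
Definition h5 : sm W := / (#3 * (j * j)) * (h1 * j + #3 * D j).
Definition h7 : sm W := - der Dq h5 * (j * j).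
Definition h9 : sm W := #2 * j * D h5 - h2 + (j * j) * (h5 * h5).
Definition hK : sm W := h9 * / (j * j).
Definition h6 : sm W := #(2/3) * der Dq j * h1 - #(1/3) * der Dq h1 * j
  - #2 * der Dp j + #2 * j * h4 * h5.
Definition h8 : sm W := der Dq h4.
Definition h10 : sm W := h4 * D h7 - j * der Dp h7 + (j * j) * der Du (h4 * / j).
Definition h11 : sm W := der Du j - D h7.
Definition h12 : sm W :=
  #6 * h1 * j * (h5 * h7 - h4 * D h5) - #18 * (j * j * j) * h4
  + #6 * der Dp h5 * h1 * (j * j) - #18 * h2 * j * h4 * h5
  - #18 * j * h7 * D h5 + #18 * (j * j) * der Du h5
  + #18 * h2 * D h4 + #2 * (h1 * h1) * h7 - #9 * der Dp h2 * j
  + #6 * (j * j) * der Du (h1 * / j) + #36 * h2 * h7.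

Hypothesis Hj : unit j.

Lemma unit_3jj : unit (#3 * (j * j)).
Proof. apply unit_mul; [apply unit_const; lra | auto with unit]. Qed.

(* [dlog] plays the role of the total derivative of [ln lam], where [lam] is the
   contact factor; [dlog_p] and [dlog_u] are then its [p]- and [u]-derivatives. *)
Definition dlog : sm W := j * h5.
Definition dlog_p : sm W := (h4 * dlog - h7) * / j.
Definition dlog_u : sm W := der Dp dlog - D dlog_p.

Ltac byfield :=
  apply sm_ext; let w := fresh "w" in intro w; autorewrite with val;
  rewrite ?val_inv by auto using unit_3jj with unit; autorewrite with val;
  assert (val j w <> 0%R) by apply Hj; field; auto.

Lemma h5_dlog : h5 = dlog * / j.
Proof. unfold dlog. byfield. Qed.

Lemma h1_dlog : h1 = #3 * dlog - #3 * D j * / j.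
Proof. unfold dlog, h5. byfield. Qed.

(** The definition of [I7] solved for the [q]-derivative of [J3 I5]. It matches [D ln lam], since on
    functions free of [q] the commutator of the [q]-derivative with [D] is the [p]-derivative. *)
Lemma dlog_q : der Dq dlog = dlog_p.
Proof.
  unfold dlog_p, h7. rewrite h5_dlog. rewrite !der_mul, der_inv by auto.
  unfold h4. byfield.
Qed.

Lemma der_f_q : der Dq f = #3 * D j * / j - #3 * dlog.
Proof. transitivity (- h1). unfold h1. byfield. rewrite h1_dlog. byfield. Qed.

Lemma der_f_p : der Dp f = #(-(2/9)) * (h1 * h1) - h2 - #(1/3) * D h1.
Proof. unfold h2. byfield. Qed.

Lemma der_f_u : der Du f = #(-(1/3)) * h1 * h2 - h3 - #(1/2) * D h2.
Proof. unfold h3. byfield. Qed.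

(* Given the other conditions, [I12 = 0] is thus the remaining closedness condition
   for [d ln lam]. *)
Lemma h12_eq (s : R) :
  h8 = #0 -> der Dq h7 = #0 -> der Dp h7 = der Du h4 ->
  der Dp j = D h4 + h7 -> der Du j = D h7 -> h3 = j * j * j ->
  h2 = #2 * D dlog - #2 * dlog * D j * / j + dlog * dlog - #s * (j * j) ->
  h12 = #(-18) * j * (D dlog_u - der Du dlog).
Proof.
  unfold h8. intros Hb Hcq Hcp Hjp Hju E3 E2.
  unfold h12. rewrite !h5_dlog.
  assert (Fp := der_f_p). assert (Fu := der_f_u). assert (Fq := der_f_q).
  rewrite E3 in Fu. rewrite E2 in Fu, Fp. rewrite E2.
  rewrite h1_dlog in Fu, Fp |- *.
  unfold dlog_u, dlog_p.
  assert (Eq := dlog_q). unfold dlog_p in Eq.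
  assert (Hq : der Dq j = h4) by reflexivity.
  (* With [h4], [h7] and [dlog] opaque and their derivatives known from the hypotheses, substituting
     the [u]- and [p]-derivatives of [f] leaves a rational identity at each point. *)
  generalize dependent dlog. generalize dependent h7. generalize dependent h4.
  intros b Hb Hq c Hcq Hcp Hjp Hju dlog E2 Fu Fp Fq Eq.
  repeat rewrite ?der_add, ?der_sub, ?der_mul, ?der_opp, ?der_const, ?der_inv,
    ?Dt_add, ?Dt_sub, ?Dt_mul, ?Dt_opp, ?Dt_const, ?Dt_inv, ?der_Dt_u, ?der_Dt_p, ?der_Dt_q,
    ?Hjp, ?Hju, ?Hq, ?Hb, ?Hcq, ?Hcp, ?Eq by auto with unit.
  repeat rewrite ?Dt_add, ?Dt_sub, ?Dt_mul, ?Dt_opp, ?Dt_const, ?Dt_inv in Fu by auto with unit.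
  repeat rewrite ?Dt_add, ?Dt_sub, ?Dt_mul, ?Dt_opp, ?Dt_const, ?Dt_inv in Fp by auto with unit.
  apply sm_ext; intro w.
  apply (f_equal (fun F => val F w)) in Fu, Fp.
  autorewrite with val in Fu, Fp |- *.
  rewrite ?val_inv in Fu, Fp |- * by auto with unit.
  rewrite Fu, Fp.
  assert (val j w <> 0%R) by apply Hj.
  field; auto.
Qed.
End Invariants.

(** * Closed forms along the equation *)

Ltac at_pt w H := apply (f_equal (fun F => val F w)) in H; autorewrite with val in H.

(** The hypotheses are the frame commutators applied to the sought [F]; the [x]-component of [d F]
    is what remains of [A0] after removing the vertical terms of the total derivative. *)
Lemma frame_poincare x0 u0 p0 q0 r (f : sm (box_domain x0 u0 p0 q0 r))
  (A0 Au Ap Aq : sm (box_domain x0 u0 p0 q0 r)) :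
  der Du A0 = Dt f Au + der Du f * Aq ->
  der Dp A0 = Dt f Ap + Au + der Dp f * Aq ->
  der Dq A0 = Dt f Aq + Ap + der Dq f * Aq ->
  der Dp Au = der Du Ap -> der Dq Au = der Du Aq -> der Dq Ap = der Dp Aq ->
  exists F, Dt f F = A0 /\ der Du F = Au /\ der Dp F = Ap /\ der Dq F = Aq.
Proof.
  intros H1 H2 H3 H4 H5 H6.
  set (Ax := A0 - sm_coord _ Dp * Au - sm_coord _ Dq * Ap - f * Aq).
  destruct (poincare x0 u0 p0 q0 r
    (fun d => match d with Dx => Ax | Du => Au | Dp => Ap | Dq => Aq end)) as [F HF].
  - assert (X1 : der Du Ax = der Dx Au).
    { unfold Ax. autorewrite with der. rewrite !der_coord. simpl dir_eqb. cbv iota.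
      rewrite H1, <- H4, <- H5. unfold Dt. apply sm_ext; intro w; autorewrite with val; ring. }
    assert (X2 : der Dp Ax = der Dx Ap).
    { unfold Ax. autorewrite with der. rewrite !der_coord. simpl dir_eqb. cbv iota.
      rewrite H2, H4, <- H6. unfold Dt. apply sm_ext; intro w; autorewrite with val; ring. }
    assert (X3 : der Dq Ax = der Dx Aq).
    { unfold Ax. autorewrite with der. rewrite !der_coord. simpl dir_eqb. cbv iota.
      rewrite H3, H5, H6. unfold Dt. apply sm_ext; intro w; autorewrite with val; ring. }
    intros d e; destruct d, e; auto.
  - exists F. unfold Dt. rewrite !HF. repeat split.
    unfold Ax. apply sm_ext; intro w; autorewrite with val; ring.
Qed.

(* A one-form annihilated by the total derivative, given by its components along
   [du - p dx], [dp - q dx], [dq - f dx]. *)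
Record vform (W : domain) := { cu : sm W; cp : sm W; cq : sm W }.
Arguments cu {W}. Arguments cp {W}. Arguments cq {W}.

Section Curl.
Context {W : domain} (f phi : sm W).
Local Notation D := (Dt f).
Local Notation a := (Dt f phi).

(** [O' = L_(D/a) O]. *)
Definition lie_deriv (O O' : vform W) : Prop :=
  D (cu O) + der Du f * cq O = a * cu O' /\
  D (cp O) + cu O + der Dp f * cq O = a * cp O' /\
  D (cq O) + cp O + der Dq f * cq O = a * cq O'.

(** [d O = d phi /\ O'], vertical components. *)
Definition vd_eq (O O' : vform W) : Prop :=
  der Dp (cu O) - der Du (cp O) = der Dp phi * cu O' - der Du phi * cp O' /\
  der Dq (cu O) - der Du (cq O) = der Dq phi * cu O' - der Du phi * cq O' /\
  der Dq (cp O) - der Dp (cq O) = der Dq phi * cp O' - der Dp phi * cq O'.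

(** For [X = D/a] one has [X phi = 1], so [L_X d phi = 0]. Applying [L_X] to [d O = d phi /\ O']
    therefore gives [d O' = d phi /\ O'']. *)
Lemma vd_step O O' O'' : unit a ->
  lie_deriv O O' -> lie_deriv O' O'' -> vd_eq O O' -> vd_eq O' O''.
Proof.
  destruct O as [Ou Op Oq], O' as [Pu Pp Pq], O'' as [Qu Qp Qq].
  unfold lie_deriv, vd_eq. simpl.
  intros Ha [Lu [Lp Lq]] [Mu [Mp Mq]] [Cup [Cuq Cpq]].
  assert (Lup := f_equal (der Dp) Lu). assert (Luq := f_equal (der Dq) Lu).
  assert (Lpu := f_equal (der Du) Lp). assert (Lpq := f_equal (der Dq) Lp).
  assert (Lqu := f_equal (der Du) Lq). assert (Lqp := f_equal (der Dp) Lq).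
  assert (Dup := f_equal (Dt f) Cup). assert (Duq := f_equal (Dt f) Cuq).
  assert (Dpq := f_equal (Dt f) Cpq). clear Lu Lp Lq.
  autorewrite with der in Lup, Luq, Lpu, Lpq, Lqu, Lqp.
  autorewrite with der in Dup, Duq, Dpq.
  rewrite (der_comm Dp Du f) in Lup. rewrite (der_comm Dq Du f) in Luq.
  rewrite (der_comm Dq Dp f) in Lpq.
  (* The differentiated relations yield the conclusion multiplied by [a], which is cancelled
     pointwise. *)
  assert (V : forall X Y : sm W,
     (forall w, (val a w * (val X w - val Y w) = 0)%R) -> X = Y).
  { intros X Y H. apply sm_ext. intro w. apply Rminus_diag_uniq.
    destruct (Rmult_integral _ _ (H w)); auto. now destruct (Ha w). }
  split; [|split]; apply V; clear V; intro w;
  at_pt w Lup; at_pt w Luq; at_pt w Lpu; at_pt w Lpq; at_pt w Lqu; at_pt w Lqp;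
  at_pt w Dup; at_pt w Duq; at_pt w Dpq;
  at_pt w Mu; at_pt w Mp; at_pt w Mq; at_pt w Cup; at_pt w Cuq; at_pt w Cpq;
  autorewrite with val.
  (* Products are atoms for [lra], so the multiples of the relations by components of [d phi] and
     [d f] are supplied. *)
  - assert (X1 := f_equal (fun z => val (der Dp phi) w * z)%R Mu).
    assert (X2 := f_equal (fun z => val (der Du phi) w * z)%R Mp).
    assert (X3 := f_equal (fun z => val (der Du f) w * z)%R Cpq).
    assert (X4 := f_equal (fun z => val (der Dp f) w * z)%R Cuq).
    cbv beta in *. lra.
  - assert (X1 := f_equal (fun z => val (der Dq phi) w * z)%R Mu).
    assert (X2 := f_equal (fun z => val (der Du phi) w * z)%R Mq).
    assert (X4 := f_equal (fun z => val (der Dq f) w * z)%R Cuq).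
    cbv beta in *. lra.
  - assert (X1 := f_equal (fun z => val (der Dq phi) w * z)%R Mp).
    assert (X2 := f_equal (fun z => val (der Dp phi) w * z)%R Mq).
    assert (X4 := f_equal (fun z => val (der Dq f) w * z)%R Cpq).
    cbv beta in *. lra.
Qed.
End Curl.

(** * The rescaled coframe and the coefficients it forces on the equation *)

Section Laguerre.
Context {W : domain} (f a lam m : sm W) (s : R).
Local Notation D := (Dt f).
Hypothesis Ha : unit a.

(* [O1 = lam (du - p dx)], and each [O_(i+1)] is to be the Lie derivative of [O_i] along
   [D/a]; that [O4 = s O2 + O1] is the third one says that the equation is canonical. *)
Definition O1 : vform W := {| cu := lam; cp := #0; cq := #0 |}.
Definition O2 : vform W := {| cu := D lam * / a; cp := lam * / a; cq := #0 |}.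
Definition O3 : vform W := {| cu := D (cu O2) * / a;
  cp := (D (cp O2) + cu O2) * / a; cq := cp O2 * / a |}.
Definition O4 : vform W := {| cu := #s * cu O2 + lam; cp := #s * cp O2; cq := #0 |}.

(* The values of [I1] and [I2] forced by [a] and [lam]. *)
Definition G1 : sm W := #3 * m - #3 * D a * / a.
Definition G2 : sm W := #2 * D m - #2 * m * D a * / a + m * m - #s * (a * a).

Hypothesis Hm : D lam = lam * m.

Ltac finish :=
  repeat (autorewrite with der; rewrite ?Dt_inv, ?Hm by auto with unit);
  apply sm_ext; let w := fresh "w" in intro w; autorewrite with val;
  rewrite ?val_inv by auto with unit; autorewrite with val;
  assert (val a w <> 0%R) by apply Ha; field; auto.

(** Here and in the next two identities the bracket is the defect of [I1 = G1], of [I2 = G2] and of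
    [I3 = - a^3], each read modulo the preceding ones. The derivatives of [f] enter as free
    parameters, so the same identities serve both directions of the equivalence. *)
Lemma laguerre_q Fq : D (cq O3) + cp O3 + Fq * cq O3 = lam * / a * / a * (Fq + G1).
Proof. unfold O3, O2, G1; simpl. finish. Qed.

Lemma laguerre_p Fp : D (cp O3) + cu O3 + Fp * cq O3 =
  a * cp O4 + lam * / a * / a * (Fp + #(2/9) * (G1 * G1) + G2 + #(1/3) * D G1).
Proof. unfold O4, O3, O2, G1, G2; simpl. finish. Qed.

Lemma laguerre_u Fu : D (cu O3) + Fu * cq O3 =
  a * cu O4 + lam * / a * / a * (Fu + #(1/3) * G1 * G2 - a * a * a + #(1/2) * D G2).
Proof. unfold O4, O3, O2, G1, G2; simpl. finish. Qed.

End Laguerre.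

(** * Exponentials and the flat affine system *)

Lemma sm_exp W (l : sm W) : exists lam : sm W, unit lam /\ forall d, der d lam = lam * der d l.
Proof.
  set (H := smooth4_exp W (dom_open W) l (ev_smooth l)).
  exists (lift _ H). split.
  - intro w. rewrite val_lift. apply Rgt_not_eq, exp_pos.
  - intro d. apply sm_ext. intro w. rewrite val_mul, val_lift. apply der_lift.
    apply is_pd_comp. apply is_derive_exp. apply sm_is_pd.
Qed.

Lemma sm_ode_sol W (phi : sm W) s : exists V : nat -> sm W,
  (forall n w, val (V n) w = ode_sol s n (val phi w)) /\
  (forall n d, der d (V n) = V (S n) * der d phi).
Proof.
  assert (H : forall n, smooth4 W (fun x u p q => ode_sol s n (phi x u p q))).
  { intro n. apply (smooth4_comp W (dom_open W) (ode_sol s) (fun _ => True)); auto.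
    intros; apply ode_sol_derive. apply ev_smooth. }
  exists (fun n => lift _ (H n)). split.
  - intros n w. now rewrite val_lift.
  - intros n d. apply sm_ext. intro w. rewrite val_mul, val_lift. apply der_lift.
    apply is_pd_comp. apply ode_sol_derive. apply sm_is_pd.
Qed.

Section Row.
Variables x0 u0 p0 q0 r : R.
Local Notation B := (box_domain x0 u0 p0 q0 r).
Variables (f phi : sm B) (s : R).

(* A row [(r1, r2, r3)] of [exp (- phi A)], with [A] the companion matrix,
   turns the flat system [d Y = A Y d phi + O] into a closed form. *)
Lemma row_primitive (A1 A2 A3 A4 : vform B) (r1 r2 r3 : sm B) :
  lie_deriv f phi A1 A2 -> lie_deriv f phi A2 A3 -> lie_deriv f phi A3 A4 ->
  vd_eq phi A1 A2 -> vd_eq phi A2 A3 -> vd_eq phi A3 A4 ->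
  cu A4 = #s * cu A2 + cu A1 -> cp A4 = #s * cp A2 + cp A1 -> cq A4 = #s * cq A2 + cq A1 ->
  (forall d, der d r1 = - (r3 * der d phi)) ->
  (forall d, der d r2 = - ((r1 + #s * r3) * der d phi)) ->
  (forall d, der d r3 = - (r2 * der d phi)) ->
  exists Z, Dt f Z = #0 /\ der Du Z = r1 * cu A1 + r2 * cu A2 + r3 * cu A3 /\
    der Dp Z = r1 * cp A1 + r2 * cp A2 + r3 * cp A3 /\
    der Dq Z = r1 * cq A1 + r2 * cq A2 + r3 * cq A3.
Proof.
  destruct A1 as [a1 b1 c1], A2 as [a2 b2 c2], A3 as [a3 b3 c3], A4 as [a4 b4 c4].
  unfold lie_deriv, vd_eq; simpl.
  intros [L1a [L1b L1c]] [L2a [L2b L2c]] [L3a [L3b L3c]]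
    [C1a [C1b C1c]] [C2a [C2b C2c]] [C3a [C3b C3c]] -> -> -> R1 R2 R3.
  assert (D1 : Dt f r1 = - (r3 * Dt f phi)).
  { unfold Dt. rewrite !R1. apply sm_ext; intro w; autorewrite with val; ring. }
  assert (D2 : Dt f r2 = - ((r1 + #s * r3) * Dt f phi)).
  { unfold Dt. rewrite !R2. apply sm_ext; intro w; autorewrite with val; ring. }
  assert (D3 : Dt f r3 = - (r2 * Dt f phi)).
  { unfold Dt. rewrite !R3. apply sm_ext; intro w; autorewrite with val; ring. }
  apply frame_poincare; autorewrite with der; rewrite ?R1, ?R2, ?R3, ?D1, ?D2, ?D3;
    apply sm_ext; intro w.
  - at_pt w L1a; at_pt w L2a; at_pt w L3a; autorewrite with val.
    apply (f_equal (Rmult (val r1 w))) in L1a. apply (f_equal (Rmult (val r2 w))) in L2a.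
    apply (f_equal (Rmult (val r3 w))) in L3a. lra.
  - at_pt w L1b; at_pt w L2b; at_pt w L3b; autorewrite with val.
    apply (f_equal (Rmult (val r1 w))) in L1b. apply (f_equal (Rmult (val r2 w))) in L2b.
    apply (f_equal (Rmult (val r3 w))) in L3b. lra.
  - at_pt w L1c; at_pt w L2c; at_pt w L3c; autorewrite with val.
    apply (f_equal (Rmult (val r1 w))) in L1c. apply (f_equal (Rmult (val r2 w))) in L2c.
    apply (f_equal (Rmult (val r3 w))) in L3c. lra.
  - at_pt w C1a; at_pt w C2a; at_pt w C3a; autorewrite with val.
    apply (f_equal (Rmult (val r1 w))) in C1a. apply (f_equal (Rmult (val r2 w))) in C2a.
    apply (f_equal (Rmult (val r3 w))) in C3a. lra.
  - at_pt w C1b; at_pt w C2b; at_pt w C3b; autorewrite with val.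
    apply (f_equal (Rmult (val r1 w))) in C1b. apply (f_equal (Rmult (val r2 w))) in C2b.
    apply (f_equal (Rmult (val r3 w))) in C3b. lra.
  - at_pt w C1c; at_pt w C2c; at_pt w C3c; autorewrite with val.
    apply (f_equal (Rmult (val r1 w))) in C1c. apply (f_equal (Rmult (val r2 w))) in C2c.
    apply (f_equal (Rmult (val r3 w))) in C3c. lra.
Qed.
End Row.

Definition vd_affine {W} (phi Y Y' : sm W) (A : vform W) : Prop :=
  der Du Y = Y' * der Du phi + cu A /\ der Dp Y = Y' * der Dp phi + cp A /\
  der Dq Y = Y' * der Dq phi + cq A.

Section Flat.
Variables x0 u0 p0 q0 r : R.
Local Notation B := (box_domain x0 u0 p0 q0 r).
Variables (f phi : sm B) (s : R).

Lemma flat_system (A1 A2 A3 A4 : vform B) :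
  lie_deriv f phi A1 A2 -> lie_deriv f phi A2 A3 -> lie_deriv f phi A3 A4 ->
  vd_eq phi A1 A2 -> vd_eq phi A2 A3 -> vd_eq phi A3 A4 ->
  cu A4 = #s * cu A2 + cu A1 -> cp A4 = #s * cp A2 + cp A1 -> cq A4 = #s * cq A2 + cq A1 ->
  exists Y1 Y2 Y3,
    Dt f Y1 = Dt f phi * Y2 /\ Dt f Y2 = Dt f phi * Y3 /\
    Dt f Y3 = Dt f phi * (#s * Y2 + Y1) /\
    vd_affine phi Y1 Y2 A1 /\ vd_affine phi Y2 Y3 A2 /\
    vd_affine phi Y3 (#s * Y2 + Y1) A3.
Proof.
  intros L1 L2 L3 C1 C2 C3 Eu Ep Eq.
  destruct (sm_ode_sol _ phi s) as [V [HV dV]].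
  assert (dV0 := dV 0%nat). assert (dV1 := dV 1%nat). assert (dV2 := dV 2%nat).
  assert (V3 : V 3%nat = #s * V 1%nat + V 0%nat).
  { apply sm_ext. intro w. autorewrite with val. rewrite !HV. apply ode_sol_rec. }
  (* The matrix with rows [(e - s c, b, c)], [(c, e, b)], [(b, g, e)] is [exp (phi A)]. *)
  assert (Det : forall w, let c := val (V 0%nat) w in let b := val (V 1%nat) w in
    let e := val (V 2%nat) w in let g := val (V 3%nat) w in
    ((e - s * c) * (e * e - b * g) - b * (c * e - b * b) + c * (c * g - e * b) = 1)%R).
  { intro w. rewrite <- (ode_sol_det s (val phi w)). rewrite V3. autorewrite with val.
    rewrite !HV. cbv zeta. ring. }
  set (c := V 0%nat) in *. set (b := V 1%nat) in *. set (e := V 2%nat) in *.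
  rewrite V3 in *. clearbody c b e. clear V HV dV V3.
  set (g := #s * b + c) in *. set (a := e - #s * c).
  (* By determinant 1 the adjugate is the inverse, so its rows are those of [exp (- phi A)]; each of
     them yields one primitive. *)
  assert (R := row_primitive x0 u0 p0 q0 r f phi s A1 A2 A3 A4).
  destruct (R (e * e - b * g) (c * g - b * e) (b * b - c * e)) as [Z1 [Z1d [Z1u [Z1p Z1q]]]];
    auto; try (intro d; unfold g; autorewrite with der; rewrite !dV0, !dV1, !dV2; unfold g;
    apply sm_ext; intro; autorewrite with val; ring).
  destruct (R (b * b - c * e) (a * e - c * b) (c * c - a * b)) as [Z2 [Z2d [Z2u [Z2p Z2q]]]];
    auto; try (intro d; unfold a, g; autorewrite with der; rewrite !dV0, ?dV1, !dV2; unfold g;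
    apply sm_ext; intro; autorewrite with val; ring).
  destruct (R (c * g - e * b) (b * b - a * g) (a * e - b * c)) as [Z3 [Z3d [Z3u [Z3p Z3q]]]];
    auto; try (intro d; unfold a, g; autorewrite with der; rewrite !dV0, ?dV1, !dV2; unfold g;
    apply sm_ext; intro; autorewrite with val; ring).
  assert (Dc : Dt f c = b * Dt f phi).
  { unfold Dt. rewrite !dV0. apply sm_ext; intro w; autorewrite with val; ring. }
  assert (Db : Dt f b = e * Dt f phi).
  { unfold Dt. rewrite !dV1. apply sm_ext; intro w; autorewrite with val; ring. }
  assert (De : Dt f e = g * Dt f phi).
  { unfold Dt. rewrite !dV2. apply sm_ext; intro w; autorewrite with val; ring. }
  (* Variation of constants: [Y = exp (phi A) Z] with [Z] the three primitives. *)
  exists (a * Z1 + b * Z2 + c * Z3), (c * Z1 + e * Z2 + b * Z3), (b * Z1 + g * Z2 + e * Z3).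
  clear L1 L2 L3 C1 C2 C3 Eu Ep Eq R.
  unfold vd_affine.
  unfold a, g.
  repeat split; autorewrite with der;
    rewrite ?Dc, ?Db, ?De, ?Z1d, ?Z2d, ?Z3d, ?dV0, ?dV1, ?dV2,
      ?Z1u, ?Z2u, ?Z3u, ?Z1p, ?Z2p, ?Z3p, ?Z1q, ?Z2q, ?Z3q; unfold a, g;
    apply sm_ext; intro w; specialize (Det w); cbv zeta in Det; unfold g in Det;
    autorewrite with val in Det |- *; try ring.
  (* The inhomogeneous terms carry the product of matrix and adjugate, that is the determinant;
     replacing a 1 in the goal by it leaves a ring identity. *)
  all: match goal with |- (?L = ?M + ?X)%R =>
    transitivity (L + (X - 1 * X))%R; [ring | rewrite <- Det; ring] end.
Qed.
End Flat.

(** * Construction of the contact transformation *)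

Section Consequences.
Context {W : domain} (f j : sm W).
Hypothesis Hj : unit j.
Local Notation D := (Dt f).

(** By the commutator of the [q]-derivative with [D], [I6] is the defect of the closedness of
    [d phi] between [D] and the [p]-derivative. *)
Lemma h7_h6 : h7 f j = h6 f j + (der Dp j - D (h4 j)).
Proof.
  unfold h7, h6, h5.
  repeat (autorewrite with der; rewrite ?der_inv by auto using unit_3jj).
  unfold h4. assert (E : der Dq f = - h1 f).
  { unfold h1. apply sm_ext; intro w; autorewrite with val; ring. }
  rewrite E. apply sm_ext; intro w; autorewrite with val.
  rewrite ?val_inv by auto using unit_3jj. autorewrite with val.
  assert (val j w <> 0%R) by apply Hj. field. auto.
Qed.

(** The first bracket vanishes with [I11]; what remains of [I10] is the closedness of [d phi] in the
    [u] and [p] directions. *)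
Lemma h10_eq : h10 f j = h4 j * (D (h7 f j) - der Du j) +
  j * (der Du (h4 j) - der Dp (h7 f j)).
Proof.
  unfold h10. autorewrite with der. rewrite der_inv by auto.
  apply sm_ext; intro w; autorewrite with val.
  rewrite ?val_inv by auto. autorewrite with val.
  assert (val j w <> 0%R) by apply Hj. field. auto.
Qed.

(** The definition of [K] solved for [I2]: it has the shape of [G2] with [K] in the place of [s],
    which is how the two get identified. *)
Lemma h2_hK : h2 f = #2 * D (dlog f j) - #2 * dlog f j * D j * / j + dlog f j * dlog f j
  - hK f j * (j * j).
Proof.
  unfold hK, h9, dlog. autorewrite with der.
  apply sm_ext; intro w; autorewrite with val.
  rewrite ?val_inv by auto with unit. autorewrite with val.
  assert (val j w <> 0%R) by apply Hj. field. auto.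
Qed.

Hypotheses (H6 : h6 f j = #0) (H8 : h8 j = #0) (H10 : h10 f j = #0)
  (H11 : h11 f j = #0).

Lemma der_j_p : der Dp j = D (h4 j) + h7 f j.
Proof. rewrite h7_h6, H6. apply sm_ext; intro w; autorewrite with val; ring. Qed.

Lemma der_j_u : der Du j = D (h7 f j).
Proof.
  apply sm_ext; intro w. at_pt w H11. unfold h11 in H11. autorewrite with val in H11. lra.
Qed.

Lemma h7_p : der Dp (h7 f j) = der Du (h4 j).
Proof.
  assert (E := H10). rewrite h10_eq, der_j_u in E.
  apply sm_ext; intro w. at_pt w E.
  apply Rmult_eq_reg_l with (val j w); [lra | apply Hj].
Qed.

(** The [q]-derivative of [der_j_p]: once [I8 = 0], the commutator turns [D h4] into the
    [p]-derivative of [h4], which cancels the left-hand side. *)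
Lemma h7_q : der Dq (h7 f j) = #0.
Proof.
  assert (E := f_equal (der Dq) der_j_p). rewrite der_comm in E.
  change (der Dq j) with (h4 j) in E. autorewrite with der in E.
  change (der Dq (h4 j)) with (h8 j) in E. rewrite H8 in E.
  autorewrite with der in E. apply sm_ext; intro w. at_pt w E. autorewrite with val. lra.
Qed.

Lemma dlog_p_q : der Dq (dlog_p f j) = #0.
Proof.
  assert (E := f_equal (der Dq) (eq_refl (dlog_p f j))). unfold dlog_p at 2 in E.
  autorewrite with der in E. rewrite der_inv in E by auto. rewrite dlog_q in E by auto.
  rewrite h7_q in E. change (der Dq (h4 j)) with (h8 j) in E. rewrite H8 in E.
  change (der Dq j) with (h4 j) in E.
  rewrite E. unfold dlog_p. apply sm_ext; intro w; autorewrite with val.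
  rewrite ?val_inv by auto. assert (val j w <> 0%R) by apply Hj. field. auto.
Qed.

Lemma dlog_u_q : der Dq (dlog_u f j) = #0.
Proof.
  unfold dlog_u. autorewrite with der. rewrite (der_comm Dq Dp), dlog_q, dlog_p_q by auto.
  autorewrite with der. apply sm_ext; intro w; autorewrite with val. ring.
Qed.

(** The [q]-derivative of the hypothesis: as [dlog_u] is free of [q], only the commutator term, its
    [p]-derivative, survives on the left. *)
Lemma dlog_u_p : D (dlog_u f j) = der Du (dlog f j) -> der Dp (dlog_u f j) = der Du (dlog_p f j).
Proof.
  intro E. apply (f_equal (der Dq)) in E. autorewrite with der in E.
  rewrite dlog_u_q, (der_comm Dq Du), dlog_q in E by auto. autorewrite with der in E.
  rewrite <- E. apply sm_ext; intro w; autorewrite with val. ring.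
Qed.

End Consequences.

Theorem contact_exists x0 u0 p0 q0 r (f j : sm (box_domain x0 u0 p0 q0 r)) s :
  unit j -> h3 f = j * j * j -> h6 f j = #0 -> h8 j = #0 -> h10 f j = #0 ->
  h11 f j = #0 -> h12 f j = #0 -> hK f j = #s ->
  exists phi psi chi kap lam, unit lam /\ Dt f phi = - j /\ der Dq phi = #0 /\
    Dt f psi = Dt f phi * chi /\ Dt f chi = Dt f phi * kap /\
    Dt f kap = Dt f phi * (#s * chi + psi) /\
    vd_affine phi psi chi (O1 lam) /\
    vd_affine phi chi kap (O2 f (Dt f phi) lam).
Proof.
  intros Hj E3 H6 H8 H10 H11 H12 HK.
  assert (Jp := der_j_p f j Hj H6). assert (Ju := der_j_u f j H11).
  assert (Cp := h7_p f j Hj H10 H11). assert (Cq := h7_q f j Hj H6 H8).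
  assert (Pq := dlog_p_q f j Hj H6 H8). assert (Qq := dlog_u_q f j Hj H6 H8).
  assert (E2 := h2_hK f j Hj). rewrite HK in E2.
  assert (DQ : Dt f (dlog_u f j) = der Du (dlog f j)).
  { rewrite (h12_eq f j Hj s H8 Cq Cp Jp Ju E3 E2) in H12.
    apply sm_ext; intro w. at_pt w H12.
    apply Rminus_diag_uniq. apply Rmult_integral in H12. destruct H12 as [H|H]; auto.
    apply Rmult_integral in H. destruct H as [H|H]; [lra | now destruct (Hj w)]. }
  assert (Qp := dlog_u_p f j Hj H6 H8 DQ). assert (Mq := dlog_q f j Hj).
  (* The six closedness conditions are, in order, [I11], [I6], the definition of [I4], the
     consequences [h7_p] and [h7_q], and [I8]. *)
  destruct (frame_poincare _ _ _ _ _ f (- j) (- h7 f j) (- h4 j) #0)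
    as [phi [Pd [Pu [Pp Pq0]]]].
  1-6: autorewrite with der; rewrite ?Ju, ?Jp, ?Cp, ?Cq;
    change (der Dq (h4 j)) with (h8 j); rewrite ?H8; unfold h4;
    apply sm_ext; intro w; autorewrite with val; try ring.
  (* Here they are [I12], the definition of [dlog_u], then [dlog_q], [dlog_u_p], [dlog_u_q] and
     [dlog_p_q]. *)
  destruct (frame_poincare _ _ _ _ _ f (dlog f j) (dlog_u f j) (dlog_p f j) #0)
    as [l [Ld [Lu [Lp Lq]]]].
  1-6: autorewrite with der; rewrite ?DQ, ?Mq, ?Qp, ?Qq, ?Pq; unfold dlog_u;
    apply sm_ext; intro w; autorewrite with val; try ring.
  destruct (sm_exp _ l) as [lam [Hlam dlam]].
  assert (Dlam : Dt f lam = lam * dlog f j).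
  { rewrite <- Ld. unfold Dt. rewrite !dlam. apply sm_ext; intro w; autorewrite with val; ring. }
  assert (Ha : unit (Dt f phi)) by (rewrite Pd; auto with unit).
  assert (L1 : lie_deriv f phi (O1 lam) (O2 f (Dt f phi) lam)).
  { unfold lie_deriv, O1, O2; simpl. autorewrite with der. repeat split;
    apply sm_ext; intro w; autorewrite with val; rewrite ?val_inv by auto;
    assert (val (Dt f phi) w <> 0%R) by apply Ha; field; auto. }
  assert (L2 : lie_deriv f phi (O2 f (Dt f phi) lam) (O3 f (Dt f phi) lam)).
  { unfold lie_deriv, O3; simpl. autorewrite with der. repeat split;
    apply sm_ext; intro w; autorewrite with val; rewrite ?val_inv by auto;
    assert (val (Dt f phi) w <> 0%R) by apply Ha; field; auto. }
  assert (EG1 : h1 f = G1 f (Dt f phi) (dlog f j)).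
  { rewrite (h1_dlog f j Hj), Pd. unfold G1. autorewrite with der.
    apply sm_ext; intro w; autorewrite with val; rewrite ?val_inv by auto with unit.
    autorewrite with val. assert (val j w <> 0%R) by apply Hj. field; auto. }
  assert (EG2 : h2 f = G2 f (Dt f phi) (dlog f j) s).
  { rewrite E2, Pd. unfold G2. autorewrite with der.
    apply sm_ext; intro w; autorewrite with val; rewrite ?val_inv by auto with unit.
    autorewrite with val. assert (val j w <> 0%R) by apply Hj. field; auto. }
  assert (L3 : lie_deriv f phi (O3 f (Dt f phi) lam) (O4 f (Dt f phi) lam s)).
  { unfold lie_deriv. split; [|split].
    - rewrite (laguerre_u _ _ _ _ s Ha Dlam), (der_f_u f j Hj), E3, EG1, EG2, Pd.
      apply sm_ext; intro w; autorewrite with val; ring.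
    - rewrite (laguerre_p _ _ _ _ s Ha Dlam), (der_f_p f j Hj), EG1, EG2, Pd.
      apply sm_ext; intro w; autorewrite with val; ring.
    - rewrite (laguerre_q _ _ _ _ Ha Dlam), (der_f_q f j Hj), Pd. unfold G1, O4. simpl.
      autorewrite with der.
      apply sm_ext; intro w; autorewrite with val; rewrite ?val_inv by auto with unit.
      autorewrite with val. assert (val j w <> 0%R) by apply Hj. field; auto. }
  (* The one curl computed directly; its nontrivial component is the formula defining [dlog_p]. *)
  assert (C1 : vd_eq phi (O1 lam) (O2 f (Dt f phi) lam)).
  { unfold vd_eq, O1, O2; simpl. autorewrite with der.
    rewrite !dlam, Lp, Lq, Dlam, Pp, Pu, Pq0, Pd. unfold dlog_p.
    repeat split; apply sm_ext; intro w; autorewrite with val;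
    rewrite ?val_inv by auto with unit; autorewrite with val;
    assert (val j w <> 0%R) by apply Hj; field; auto. }
  assert (C2 := vd_step _ _ _ _ _ Ha L1 L2 C1).
  assert (C3 := vd_step _ _ _ _ _ Ha L2 L3 C2).
  destruct (flat_system _ _ _ _ _ f phi s _ _ _ _ L1 L2 L3 C1 C2 C3) as
    [psi [chi [kap [D1 [D2 [D3 [V1 [V2 V3]]]]]]]].
  1-3: unfold O4, O1; simpl; apply sm_ext; intro w; autorewrite with val; ring.
  exists phi, psi, chi, kap, lam. auto 10.
Qed.

(** * Invariants of an equation equivalent to the canonical form *)

Section Equivalent.
Context {W : domain} (f phi : sm W).
Local Notation D := (Dt f).
Local Notation a := (Dt f phi).

(** The vertical part of [d F - G d phi], which is the whole form when [D F = a G]. *)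
Definition vert (F G : sm W) : vform W := {| cu := der Du F - G * der Du phi;
  cp := der Dp F - G * der Dp phi; cq := der Dq F - G * der Dq phi |}.

Lemma vert_lie F G H : D F = a * G -> D G = a * H ->
  lie_deriv f phi (vert F G) (vert G H).
Proof.
  intros E1 E2.
  assert (Eu := f_equal (der Du) E1). assert (Ep := f_equal (der Dp) E1).
  assert (Eq := f_equal (der Dq) E1). autorewrite with der in Eu, Ep, Eq.
  unfold lie_deriv, vert; simpl. autorewrite with der. rewrite E2.
  repeat split; apply sm_ext; intro w; at_pt w Eu; at_pt w Ep; at_pt w Eq;
    autorewrite with val; lra.
Qed.

(** The exterior derivative of [d F - G d phi] is [d phi /\ d G], and subtracting [H d phi] from
    [d G] does not change the product; hence [H] is arbitrary. *)
Lemma vert_vd F G H : vd_eq phi (vert F G) (vert G H).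
Proof.
  unfold vd_eq, vert; simpl. autorewrite with der.
  rewrite !(der_comm Dq Dp), !(der_comm Dq Du), !(der_comm Dp Du).
  repeat split; apply sm_ext; intro w; autorewrite with val; ring.
Qed.

Hypothesis Ha : unit a.

Lemma lie_deriv_unique A A1 A2 : lie_deriv f phi A A1 -> lie_deriv f phi A A2 -> A1 = A2.
Proof.
  assert (X : forall X Y Z : sm W, Z = a * X -> Z = a * Y -> X = Y).
  { intros X Y Z -> H. apply sm_ext; intro w. at_pt w H.
    apply Rmult_eq_reg_l with (val a w); [exact H | apply Ha]. }
  destruct A1, A2. unfold lie_deriv; simpl. intros [? [? ?]] [? [? ?]].
  f_equal; eapply X; eauto.
Qed.

Lemma lie_O1 lam : lie_deriv f phi (O1 lam) (O2 f a lam).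
Proof.
  unfold lie_deriv, O1, O2; simpl. autorewrite with der. repeat split;
  apply sm_ext; intro w; autorewrite with val; rewrite ?val_inv by auto;
  assert (val a w <> 0%R) by apply Ha; field; auto.
Qed.

Lemma lie_O2 lam : lie_deriv f phi (O2 f a lam) (O3 f a lam).
Proof.
  unfold lie_deriv, O3; simpl. autorewrite with der. repeat split;
  apply sm_ext; intro w; autorewrite with val; rewrite ?val_inv by auto;
  assert (val a w <> 0%R) by apply Ha; field; auto.
Qed.

Lemma sm_mul_cancel (X Y Z : sm W) : unit X -> X * Y = X * Z -> Y = Z.
Proof.
  intros HX E. apply sm_ext; intro w. at_pt w E.
  apply Rmult_eq_reg_l with (val X w); auto.
Qed.

Variables (psi chi kap lam : sm W) (s : R).
Hypotheses (Hlam : unit lam) (phi_q : der Dq phi = #0)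
  (D1 : D psi = a * chi) (D2 : D chi = a * kap) (D3 : D kap = a * (#s * chi + psi))
  (V1 : vert psi chi = O1 lam).

Local Notation m := (D lam * / lam).

Lemma D_lam : D lam = lam * m.
Proof.
  apply sm_ext; intro w; autorewrite with val. rewrite val_inv by auto.
  assert (val lam w <> 0%R) by apply Hlam. field; auto.
Qed.

(** Lie derivatives along [D/a] are unique since [a] is a unit, so the forms built from [psi],
    [chi], [kap] must be [O1], [O2], [O3]; the fourth is [s O2 + O1] by linearity. *)
Lemma lie_O3 : lie_deriv f phi (O3 f a lam) (O4 f a lam s).
Proof.
  assert (D4 : D (#s * chi + psi) = a * (#s * kap + chi)).
  { autorewrite with der. rewrite D1, D2. apply sm_ext; intro w; autorewrite with val; ring. }
  assert (L1 := vert_lie psi chi kap D1 D2).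
  assert (L2 := vert_lie chi kap (#s * chi + psi) D2 D3).
  assert (L3 := vert_lie kap (#s * chi + psi) (#s * kap + chi) D3 D4).
  rewrite V1 in L1.
  rewrite (lie_deriv_unique _ _ _ L1 (lie_O1 lam)) in L2.
  rewrite (lie_deriv_unique _ _ _ L2 (lie_O2 lam)) in L3.
  replace (O4 f a lam s) with (vert (#s * chi + psi) (#s * kap + chi)); auto.
  assert (E2 := lie_deriv_unique _ _ _ L1 (lie_O1 lam)).
  unfold O4. rewrite <- E2.
  assert (Eu := f_equal cu V1). assert (Ep := f_equal cp V1). assert (Eq := f_equal cq V1).
  assert (Fq := f_equal cq E2).
  unfold vert, O1, O2 in *; simpl in *.
  f_equal; autorewrite with der; apply sm_ext; intro w;
  at_pt w Eu; at_pt w Ep; at_pt w Eq; at_pt w Fq; autorewrite with val; try lra.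
  apply (f_equal (Rmult s)) in Fq. lra.
Qed.

Lemma unit_lam_aa : unit (lam * / a * / a).
Proof. auto 10 with unit. Qed.

Lemma h1_G1 : h1 f = G1 f a m.
Proof.
  destruct lie_O3 as [_ [_ Lq]]. rewrite (laguerre_q f a lam m Ha D_lam) in Lq.
  apply (sm_mul_cancel (lam * / a * / a)); [apply unit_lam_aa|].
  change (cq (O4 f a lam s)) with (sm_const W 0) in Lq.
  unfold h1. apply sm_ext; intro w; at_pt w Lq. autorewrite with val. lra.
Qed.

Lemma h2_G2 : h2 f = G2 f a m s.
Proof.
  destruct lie_O3 as [_ [Lp _]]. rewrite (laguerre_p f a lam m s Ha D_lam) in Lp.
  apply (sm_mul_cancel (lam * / a * / a)); [apply unit_lam_aa|].
  unfold h2. rewrite h1_G1. apply sm_ext; intro w; at_pt w Lp.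
  autorewrite with val. lra.
Qed.

Lemma h3_cube : h3 f = - a * - a * - a.
Proof.
  destruct lie_O3 as [Lu _]. rewrite (laguerre_u f a lam m s Ha D_lam) in Lu.
  apply (sm_mul_cancel (lam * / a * / a)); [apply unit_lam_aa|].
  unfold h3. rewrite h1_G1, h2_G2. apply sm_ext; intro w; at_pt w Lu.
  autorewrite with val. lra.
Qed.

(** The components of [d O1 = d phi /\ O2] in the directions [u, q] and [u, p]. *)
Lemma contact_lam : der Dq lam = #0 /\ a * der Dp lam + lam * der Du phi = D lam * der Dp phi.
Proof.
  assert (C := vert_vd psi chi kap).
  assert (E := lie_deriv_unique _ _ _ (vert_lie psi chi kap D1 D2)
    (eq_ind_r (fun A => lie_deriv f phi A _) (lie_O1 lam) V1)).
  rewrite V1, E in C. unfold vd_eq, O1, O2 in C; simpl in C.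
  rewrite phi_q in C. autorewrite with der in C. destruct C as [C1 [C2 _]].
  split; apply sm_ext; intro w; at_pt w C1; at_pt w C2; autorewrite with val; [lra|].
  rewrite val_inv in C1 by auto. assert (N : val a w <> 0%R) by apply Ha.
  replace (val (der Dp lam) w) with (val (der Dp lam) w - 0)%R by ring. rewrite C1.
  field; auto.
Qed.

Local Notation j := (- a).

Lemma unit_opp_a : unit j.
Proof. auto with unit. Qed.

Lemma h4_phi : h4 j = - der Dp phi.
Proof.
  unfold h4. autorewrite with der. rewrite phi_q. autorewrite with der.
  apply sm_ext; intro w; autorewrite with val; ring.
Qed.

Lemma m_lam : dlog f j = m.
Proof.
  unfold dlog, h5. rewrite h1_G1. unfold G1. autorewrite with der.
  apply sm_ext; intro w; autorewrite with val.
  rewrite ?val_inv by auto using unit_3jj with unit. autorewrite with val.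
  assert (val a w <> 0%R) by apply Ha. assert (val lam w <> 0%R) by apply Hlam. field; auto.
Qed.

Lemma m_lam_q : der Dq m = der Dp lam * / lam.
Proof.
  destruct contact_lam as [Lq _]. autorewrite with der. rewrite der_inv by auto.
  rewrite Lq. autorewrite with der. apply sm_ext; intro w; autorewrite with val. ring.
Qed.

(** Two expressions for the [p]-derivative of [ln lam] are compared, one from [dlog_q] and one from
    the contact condition. *)
Lemma h7_phi : h7 f j = - der Du phi.
Proof.
  assert (E := dlog_q f j unit_opp_a). rewrite m_lam, m_lam_q in E. unfold dlog_p in E.
  rewrite h4_phi, m_lam in E. destruct contact_lam as [_ C].
  apply sm_ext; intro w; at_pt w E; at_pt w C. autorewrite with val.
  rewrite !val_inv in E by auto with unit. autorewrite with val in E.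
  assert (Na : val a w <> 0%R) by apply Ha. assert (Nl : val lam w <> 0%R) by apply Hlam.
  assert (E' : (val a w * val (der Dp lam) w =
    val (der Dp phi) w * val (D lam) w + val (h7 f j) w * val lam w)%R).
  { transitivity (val (der Dp lam) w * / val lam w * (val a w * val lam w))%R.
    field; auto. rewrite E. field; auto. }
  apply Rmult_eq_reg_l with (val lam w); auto. lra.
Qed.

Theorem invariants_vanish : h6 f j = #0 /\ h8 j = #0 /\ h10 f j = #0 /\ h11 f j = #0 /\
  h12 f j = #0 /\ hK f j = #s.
Proof.
  assert (Jp : der Dp j = D (h4 j) + h7 f j).
  { rewrite h4_phi, h7_phi. autorewrite with der. rewrite phi_q.
    apply sm_ext; intro w; autorewrite with val; ring. }
  assert (Ju : der Du j = D (h7 f j)).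
  { rewrite h7_phi. autorewrite with der. rewrite phi_q.
    apply sm_ext; intro w; autorewrite with val; ring. }
  assert (Cp : der Dp (h7 f j) = der Du (h4 j)).
  { rewrite h4_phi, h7_phi. autorewrite with der. now rewrite (der_comm Dp Du). }
  assert (Cq : der Dq (h7 f j) = #0).
  { rewrite h7_phi. autorewrite with der. rewrite (der_comm Dq Du), phi_q.
    autorewrite with der. apply sm_ext; intro w; autorewrite with val; ring. }
  assert (H8 : h8 j = #0).
  { unfold h8. rewrite h4_phi. autorewrite with der. rewrite (der_comm Dq Dp), phi_q.
    autorewrite with der. apply sm_ext; intro w; autorewrite with val; ring. }
  assert (E2 : h2 f = #2 * D (dlog f j) - #2 * dlog f j * D j * / j + dlog f j * dlog f j
    - #s * (j * j)).
  { rewrite h2_G2, m_lam. unfold G2. autorewrite with der.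
    apply sm_ext; intro w; autorewrite with val; rewrite ?val_inv by auto with unit.
    autorewrite with val. assert (val a w <> 0%R) by apply Ha. 
    assert (val lam w <> 0%R) by apply Hlam. field; auto. }
  assert (K : hK f j = #s).
  { assert (E := h2_hK f j unit_opp_a). rewrite E2 in E.
    apply sm_ext; intro w; at_pt w E. autorewrite with val in E |- *.
    assert (Na : val a w <> 0%R) by apply Ha.
    apply Rmult_eq_reg_l with (val a w * val a w)%R; [lra|].
    now apply Rmult_integral_contrapositive_currified. }
  assert (DQ : D (dlog_u f j) = der Du (dlog f j)).
  (* Since [lam] is free of [q], the commutator of the [p]-derivative with [D] makes [dlog_u] the
     [u]-derivative of [ln lam]; that derivative then commutes with [D] on [ln lam]. *)
  { assert (EQ : dlog_u f j = der Du lam * / lam).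
    { unfold dlog_u. rewrite <- (dlog_q f j unit_opp_a), m_lam, m_lam_q.
      autorewrite with der. rewrite der_inv, Dt_inv by auto.
      destruct contact_lam as [Lq _]. rewrite Lq.
      apply sm_ext; intro w; autorewrite with val; rewrite ?val_inv by auto.
      assert (val lam w <> 0%R) by apply Hlam. field; auto. }
    rewrite EQ, m_lam. autorewrite with der. rewrite der_inv, Dt_inv by auto.
    destruct contact_lam as [Lq _]. rewrite Lq.
    apply sm_ext; intro w; autorewrite with val; rewrite ?val_inv by auto.
    assert (val lam w <> 0%R) by apply Hlam. field; auto. }
  repeat split; auto.
  - assert (E := h7_h6 f j unit_opp_a). rewrite Jp in E.
    apply sm_ext; intro w; at_pt w E. autorewrite with val in E |- *. lra.
  - rewrite h10_eq by apply unit_opp_a. rewrite Ju, Cp.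
    apply sm_ext; intro w; autorewrite with val; ring.
  - unfold h11. rewrite Ju. apply sm_ext; intro w; autorewrite with val; ring.
  - rewrite (h12_eq f j unit_opp_a s H8 Cq Cp Jp Ju h3_cube E2), DQ.
    apply sm_ext; intro w; autorewrite with val; ring.
Qed.

End Equivalent.

(** * Back to functions of several real variables *)

Local Close Scope sm_scope.

Section Links.
Context {W : domain}.

Definition rep (F : fun4) (G : sm W) : Prop :=
  forall w : pt W, F (px w) (pu w) (pp w) (pq w) = val G w.

Lemma rep_eq_on F G : rep F G -> eq_on W F G.
Proof. intros H x u p q h. apply (H (Pt W x u p q h)). Qed.

Lemma rep_lift F H : rep F (lift F H).
Proof. intro w. now rewrite val_lift. Qed.

Lemma rep_pd d F G : rep F G -> rep (pd d F) (der d G).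
Proof.
  intros H w. rewrite val_der.
  apply (pd_eq_on W); [apply dom_open | now apply rep_eq_on | apply pt_in].
Qed.

Lemma rep_div F F' G G' : rep F F' -> rep G G' -> unit G' ->
  rep (fun x u p q => F x u p q / G x u p q) (F' * / G')%sm.
Proof. intros H1 H2 H w. rewrite H1, H2, val_mul, val_inv by auto. reflexivity. Qed.

Lemma val_coord d w : val (sm_coord W d) w = coord d (px w) (pu w) (pp w) (pq w).
Proof. unfold sm_coord. now rewrite val_lift. Qed.

Lemma val_Dt (g F : sm W) w : val (Dt g F) w = val (der Dx F) w + pp w * val (der Du F) w
  + pq w * val (der Dp F) w + val g w * val (der Dq F) w.
Proof. unfold Dt. autorewrite with val. now rewrite !val_coord. Qed.

Variables (f : fun4) (g : sm W).
Hypothesis Hf : rep f g.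

Lemma rep_Dhat F G : rep F G -> rep (Dhat f F) (Dt g G).
Proof.
  intros H w. unfold Dhat, fx, fu, fp, fq.
  rewrite val_Dt, (rep_pd Dx _ _ H w), (rep_pd Du _ _ H w), (rep_pd Dp _ _ H w),
    (rep_pd Dq _ _ H w), (Hf w). reflexivity.
Qed.

Lemma rep_I1 : rep (I1 f) (h1 g).
Proof.
  intro w. unfold I1, h1, fq. rewrite (rep_pd Dq _ _ Hf w). now autorewrite with val.
Qed.

Lemma rep_I2 : rep (I2 f) (h2 g).
Proof.
  intro w. unfold I2, h2, fp.
  rewrite (rep_I1 w), (rep_pd Dp _ _ Hf w), (rep_Dhat _ _ rep_I1 w).
  autorewrite with val. ring.
Qed.

Lemma rep_I3 : rep (I3 f) (h3 g).
Proof.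
  intro w. unfold I3, h3, fu.
  rewrite (rep_I1 w), (rep_I2 w), (rep_pd Du _ _ Hf w), (rep_Dhat _ _ rep_I2 w).
  autorewrite with val. ring.
Qed.

Hypothesis HI3 : forall x u p q, W x u p q -> I3 f x u p q <> 0.

Lemma unit_h3 : unit (h3 g).
Proof. intro w. rewrite <- (rep_I3 w). apply HI3, pt_in. Qed.

Definition hJ : sm W := sm_cbrt (h3 g).
Local Notation j := hJ.

Lemma rep_J3 : rep (J3 f) j.
Proof.
  intro w. unfold J3, hJ. rewrite (rep_I3 w), val_cbrt; [reflexivity | apply unit_h3].
Qed.

Lemma unit_hJ : unit j.
Proof. intro w. unfold hJ. rewrite val_cbrt by apply unit_h3. apply cbrt_neq_0, unit_h3. Qed.

Lemma hJ_cube : (h3 g = j * j * j)%sm.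
Proof.
  apply sm_ext; intro w. autorewrite with val. unfold hJ. rewrite val_cbrt by apply unit_h3.
  rewrite <- (cbrt_cube (val (h3 g) w)) at 1. ring.
Qed.

(** Injectivity of real cubing: this is how [J3] is identified with [- D phi], sign included. *)
Lemma hJ_eq a : (h3 g = a * a * a)%sm -> hJ = a.
Proof.
  intro H. apply sm_ext; intro w. apply cube_inj.
  assert (E := f_equal (fun F => val F w) hJ_cube).
  apply (f_equal (fun F => val F w)) in H. cbv beta in E, H.
  autorewrite with val in E, H. simpl. lra.
Qed.

Lemma rep_I4 : rep (I4 f) (h4 j).
Proof. exact (rep_pd Dq _ _ rep_J3). Qed.

Lemma rep_I5 : rep (I5 f) (h5 g j).
Proof.
  intro w. unfold I5, h5. rewrite (rep_I1 w), (rep_J3 w), (rep_Dhat _ _ rep_J3 w).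
  autorewrite with val. rewrite val_inv by (apply unit_3jj, unit_hJ).
  autorewrite with val. simpl. now rewrite Rmult_1_r.
Qed.

Lemma rep_I7 : rep (I7 f) (h7 g j).
Proof.
  intro w. unfold I7, h7, fq. rewrite (rep_pd Dq _ _ rep_I5 w), (rep_J3 w).
  autorewrite with val. ring.
Qed.

Lemma rep_K : rep (K f) (hK g j).
Proof.
  intro w. unfold K, hK, I9, h9.
  rewrite (rep_Dhat _ _ rep_I5 w), (rep_I2 w), (rep_J3 w), (rep_I5 w).
  autorewrite with val. pose proof unit_hJ.
  rewrite val_inv by auto with unit. autorewrite with val. field. apply unit_hJ.
Qed.

Lemma rep_I6 : rep (I6 f) (h6 g j).
Proof.
  intro w. unfold I6, h6, fq, fp.
  rewrite (rep_pd Dq _ _ rep_J3 w), (rep_I1 w), (rep_pd Dq _ _ rep_I1 w), (rep_J3 w),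
    (rep_pd Dp _ _ rep_J3 w), (rep_I4 w), (rep_I5 w).
  autorewrite with val. ring.
Qed.

Lemma rep_I8 : rep (I8 f) (h8 j).
Proof. exact (rep_pd Dq _ _ rep_I4). Qed.

Lemma rep_I10 : rep (I10 f) (h10 g j).
Proof.
  intro w. unfold I10, h10, fu, fp.
  rewrite (rep_I4 w), (rep_Dhat _ _ rep_I7 w), (rep_J3 w), (rep_pd Dp _ _ rep_I7 w),
    (rep_pd Du _ _ (rep_div _ _ _ _ rep_I4 rep_J3 unit_hJ) w).
  autorewrite with val. ring.
Qed.

Lemma rep_I11 : rep (I11 f) (h11 g j).
Proof.
  intro w. unfold I11, h11, fu.
  rewrite (rep_pd Du _ _ rep_J3 w), (rep_Dhat _ _ rep_I7 w).
  autorewrite with val. ring.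
Qed.

Lemma rep_I12 : rep (I12 f) (h12 g j).
Proof.
  intro w. unfold I12, h12, fu, fp. cbv zeta.
  rewrite (rep_I1 w), (rep_I2 w), (rep_J3 w), (rep_I4 w), (rep_I5 w), (rep_I7 w),
    (rep_Dhat _ _ rep_I5 w), (rep_Dhat _ _ rep_I4 w), (rep_pd Dp _ _ rep_I5 w),
    (rep_pd Du _ _ rep_I5 w), (rep_pd Dp _ _ rep_I2 w),
    (rep_pd Du _ _ (rep_div _ _ _ _ rep_I1 rep_J3 unit_hJ) w).
  autorewrite with val. ring.
Qed.

End Links.

Section Cylinder.
Context {W : domain}.

Definition cyl (F : fun3) : fun4 := fun x u p _ => F x u p.

Lemma cyl_val (F : fun3) (G : sm W) d : rep (cyl F) G ->
  forall w, val (der d G) w = match d with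
    | Dx => d3x F (px w) (pu w) (pp w) | Du => d3u F (px w) (pu w) (pp w)
    | Dp => d3p F (px w) (pu w) (pp w) | Dq => 0 end.
Proof.
  intros H w. rewrite <- (rep_pd d _ _ H w).
  destruct d; try reflexivity.
  exact (Derive_const (F (px w) (pu w) (pp w)) (pq w)).
Qed.

Lemma D3_val (f : sm W) F G : rep (cyl F) G ->
  forall w, D3 F (px w) (pu w) (pp w) (pq w) = val (Dt f G) w.
Proof.
  intros H w. pose proof (cyl_val F G) as C.
  rewrite val_Dt, (C Dx H w), (C Du H w), (C Dp H w), (C Dq H w).
  unfold D3. ring.
Qed.

End Cylinder.

(** * Necessity of the conditions and the value of [s] *)

Lemma invariants_of_loc_equiv (U : set4) (f : fun4) x u p q s :
  smooth4 U f -> (forall x u p q, U x u p q -> I3 f x u p q <> 0) ->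
  loc_equiv_canonical U f x u p q s ->
  (I6 f x u p q = 0 /\ I8 f x u p q = 0 /\ I10 f x u p q = 0 /\
   I11 f x u p q = 0 /\ I12 f x u p q = 0 /\
   fx (K f) x u p q = 0 /\ fu (K f) x u p q = 0 /\
   fp (K f) x u p q = 0 /\ fq (K f) x u p q = 0) /\ s = K f x u p q.
Proof.
  intros Hf HI (V & phi & psi & chi & W0 & (HV & Sphi & Spsi & Schi & Jac & lam & Hlam)
    & HW & Hw & HE).
  set (W := Build_domain W0 HW).
  assert (VW : forall x u p q, W x u p q -> V x u p) by (intros; eapply HE; eauto).
  assert (HfW : smooth4 W f) by (eapply smooth4_subset; [|exact Hf]; intros; now apply HE).
  assert (HIW : forall x u p q, W x u p q -> I3 f x u p q <> 0) by (intros; now apply HI, HE).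
  set (g := lift f HfW : sm W). assert (Rf := rep_lift f HfW : rep f g).
  assert (E : forall F, smooth3 V F -> exists G : sm W, rep (cyl F) G).
  { intros F HF. assert (S : smooth4 W (cyl F)).
    { eapply smooth4_subset; [|exact HF]. intros x' u' p' q' h. exact (VW x' u' p' q' h). }
    exists (lift _ S). apply rep_lift. }
  destruct (E phi Sphi) as [Phi RPhi]. destruct (E psi Spsi) as [Psi RPsi].
  destruct (E chi Schi) as [Chi RChi]. clear E.
  assert (CPhi := fun d => cyl_val phi Phi d RPhi).
  assert (CPsi := fun d => cyl_val psi Psi d RPsi).
  assert (CChi := fun d => cyl_val chi Chi d RChi).
  set (a := Dt g Phi). 
  assert (Ha : unit a).
  { intro w. unfold a. rewrite <- (D3_val g phi Phi RPhi w).
    exact (proj1 (proj2 (proj2 (HE _ _ _ _ (pt_in w))))). }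
  (* The given contact factor is not assumed smooth; the [du] component of the contact condition
     expresses it through smooth functions. *)
  set (Lam := (der Du Psi - Chi * der Du Phi)%sm).
  assert (VLam : forall w, val Lam w = lam (px w) (pu w) (pp w)).
  { intro w. unfold Lam. autorewrite with val. rewrite (CPsi Du w), (CPhi Du w), <- (RChi w).
    apply Hlam. exact (VW _ _ _ _ (pt_in w)). }
  assert (CX : forall w, val (der Dx Psi) w =
    (val Chi w * val (der Dx Phi) w - val Lam w * pp w)%R).
  { intro w. rewrite VLam, (CPsi Dx w), (CPhi Dx w), <- (RChi w). unfold cyl.
    destruct (Hlam (px w) (pu w) (pp w)) as [h _]; [|lra].
    exact (VW _ _ _ _ (pt_in w)). }
  assert (CU : forall w, val (der Du Psi) w = (val Chi w * val (der Du Phi) w + val Lam w)%R).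
  { intro w. unfold Lam. autorewrite with val. ring. }
  assert (CP : forall w, val (der Dp Psi) w = (val Chi w * val (der Dp Phi) w)%R).
  { intro w. rewrite (CPsi Dp w), (CPhi Dp w), <- (RChi w). unfold cyl.
    destruct (Hlam (px w) (pu w) (pp w)) as [_ [_ h]]; [|lra].
    exact (VW _ _ _ _ (pt_in w)). }
  (* Where the contact factor vanishes, [d psi = chi d phi] and the Jacobian is zero. *)
  assert (HLam : unit Lam).
  { intros w h0. apply (Jac (px w) (pu w) (pp w)). exact (VW _ _ _ _ (pt_in w)).
    unfold jac3. cbv zeta.
    rewrite <- (CPhi Dx w), <- (CPhi Du w), <- (CPhi Dp w), <- (CPsi Dx w), <- (CPsi Du w),
      <- (CPsi Dp w), CX, CU, CP, h0. ring. }
  set (Kap := (Dt g Chi * / a)%sm).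
  assert (D1 : Dt g Psi = (a * Chi)%sm).
  { apply sm_ext; intro w. unfold a. autorewrite with val.
    rewrite !val_Dt, CX, CU, CP, (CPsi Dq w), (CPhi Dq w). ring. }
  assert (D2 : Dt g Chi = (a * Kap)%sm).
  { apply sm_ext; intro w. unfold Kap. autorewrite with val. rewrite val_inv by auto.
    field. apply Ha. }
  assert (RK : rep (qbar phi chi) Kap).
  { intro w. unfold qbar, Kap. autorewrite with val. rewrite val_inv by auto. unfold a.
    now rewrite (D3_val g chi Chi RChi w), (D3_val g phi Phi RPhi w). }
  assert (D3' : Dt g Kap = (a * (sm_const W s * Chi + Psi))%sm).
  { apply sm_ext; intro w. autorewrite with val.
    destruct (HE (px w) (pu w) (pp w) (pq w) (pt_in w)) as [_ [_ [_ h]]].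
    unfold rbar in h. rewrite (rep_Dhat f g Rf _ _ RK w), (D3_val g phi Phi RPhi w) in h.
    fold a in h. rewrite <- (RChi w), <- (RPsi w). unfold cyl. rewrite <- h.
    field. apply Ha. }
  assert (PQ : der Dq Phi = sm_const W 0).
  { apply sm_ext; intro w. rewrite val_const. apply (CPhi Dq w). }
  assert (V1 : vert Phi Psi Chi = O1 Lam).
  { unfold vert, O1. f_equal; apply sm_ext; intro w; autorewrite with val.
    - rewrite CP. ring.
    - rewrite (CPsi Dq w), PQ, val_const. ring. }
  assert (HJ : hJ g = (- a)%sm).
  { apply (hJ_eq f g Rf HIW).
    exact (h3_cube g Phi Ha Psi Chi Kap Lam s HLam D1 D2 D3' V1). }
  destruct (invariants_vanish g Phi Ha Psi Chi Kap Lam s HLam PQ D1 D2 D3' V1)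
    as [H6 [H8 [H10 [H11 [H12 HK]]]]].
  fold a in H6, H8, H10, H11, H12, HK. rewrite <- HJ in H6, H8, H10, H11, H12, HK.
  set (w := Pt W x u p q Hw).
  assert (RKf := rep_K f g Rf HIW). rewrite HK in RKf.
  (* [K] equals [s] on a whole neighbourhood, so its derivatives vanish at the point. *)
  assert (DK : forall d, pd d (K f) x u p q = 0).
  { intro d. rewrite (rep_pd d _ _ RKf w : pd d (K f) x u p q = _), der_const. apply val_const. }
  split; [|symmetry; rewrite (RKf w : K f x u p q = _); apply val_const].
  rewrite (rep_I6 f g Rf HIW w : I6 f x u p q = _), (rep_I8 f g Rf HIW w : I8 f x u p q = _),
    (rep_I10 f g Rf HIW w : I10 f x u p q = _), (rep_I11 f g Rf HIW w : I11 f x u p q = _),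
    (rep_I12 f g Rf HIW w : I12 f x u p q = _), H6, H8, H10, H11, H12, !val_const.
  unfold fx, fu, fp, fq. rewrite !DK. tauto.
Qed.

(** * Descent to functions of [x], [u], [p] on the slice [q = q0] *)

Section BaseSlice.
Variables x0 u0 p0 q0 r : R.
Hypothesis Hr : 0 < r.
Local Notation B := (box_domain x0 u0 p0 q0 r).

Definition box3 : set3 := fun x u p => Rabs (x - x0) < r /\ Rabs (u - u0) < r /\ Rabs (p - p0) < r.

Definition base (F : sm B) : fun3 := fun x u p => F x u p q0.

Lemma box3_box x u p : box3 x u p -> B x u p q0.
Proof. intros [h1 [h2 h3]]. repeat split; auto. now rewrite Rminus_diag, Rabs_R0. Qed.

Lemma open3_box3 : open3 box3.
Proof.
  intros x u p h. destruct (open4_box _ _ _ _ _ _ _ _ _ (box3_box x u p h)) as [e [He Bx]].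
  exists e. split; auto. intros x' u' p' h1 h2 h3.
  destruct (Bx x' u' p' q0 h1 h2 h3) as [k1 [k2 [k3 _]]].
  now rewrite Rminus_diag, Rabs_R0. repeat split; auto.
Qed.

Lemma smooth3_base F : smooth3 box3 (base F).
Proof.
  assert (HW : open4 (fun x u p _ => box3 x u p)).
  { intros x u p q h. destruct (open3_box3 x u p h) as [e [He Bx]]. exists e. auto. }
  apply (smooth4_coind _ (fun G => exists F : sm B, G = cyl (base F)) HW); [| |now exists F].
  - intros G x u p q [F' ->] h. split.
    + intros e He. destruct (smooth4_cont _ _ _ _ _ _ (ev_smooth F') (box3_box x u p h) e He)
        as [d [Hd Bx]].
      exists d. split; auto. intros. apply Bx; auto. now rewrite Rminus_diag, Rabs_R0.
    + assert (E := fun d => smooth4_ex_pd _ _ d _ _ _ _ (ev_smooth F') (box3_box x u p h)).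
      intros [| | |]; [exact (E Dx) | exact (E Du) | exact (E Dp) |].
      exact (ex_derive_const (F' x u p q0) q).
  - intros G d [F' ->].
    (* The class is closed under differentiation: a cylinder has zero [q]-derivative whatever [F']
       is, and the other derivatives commute with restriction to the slice. *)
    exists (cyl (base (match d with Dq => sm_const B 0 | _ => der d F' end))). split; eauto.
    intros x u p q h. set (w := Pt B x u p q0 (box3_box x u p h)).
    destruct d; symmetry;
      [exact (val_der Dx F' w) | exact (val_der Du F' w) | exact (val_der Dp F' w) |].
    transitivity 0; [exact (val_const 0 w)|].
    symmetry. exact (Derive_const (F' x u p q0) q).
Qed.

Lemma rep_base F : der Dq F = sm_const B 0 -> rep (cyl (base F)) F.
Proof.
  intros H w. unfold cyl, base, val.
  destruct w as [x u p q [h1 [h2 [h3 h4]]]]. simpl.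
  assert (Z : Rabs (q0 - q0) < r) by now rewrite Rminus_diag, Rabs_R0.
  assert (L : Rabs (F x u p q - F x u p q0) <= 0 * Rabs (q - q0)).
  { apply (lipschitz_interval (fun t => F x u p t) (fun _ => 0)). intros t Ht.
    split; [|rewrite Rabs_R0; apply Rle_refl].
    assert (Ht' := between_ball _ _ _ _ _ Z h4 Ht).
    set (w := Pt B x u p t (conj h1 (conj h2 (conj h3 Ht')))).
    pose proof (sm_is_pd Dq F w) as D. rewrite H, val_const in D. exact D. }
  rewrite Rmult_0_l in L. pose proof (Rabs_pos (F x u p q - F x u p q0)).
  symmetry. apply Rminus_diag_uniq, Rabs_eq_0. lra.
Qed.

End BaseSlice.

(** * Sufficiency of the conditions *)

Lemma loc_equiv_of_invariants (U : set4) (f : fun4) : open4 U -> smooth4 U f ->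
  (forall x u p q, U x u p q -> I3 f x u p q <> 0) ->
  (forall x u p q, U x u p q ->
      I6 f x u p q = 0 /\ I8 f x u p q = 0 /\ I10 f x u p q = 0 /\
      I11 f x u p q = 0 /\ I12 f x u p q = 0 /\
      fx (K f) x u p q = 0 /\ fu (K f) x u p q = 0 /\
      fp (K f) x u p q = 0 /\ fq (K f) x u p q = 0) ->
  forall x u p q, U x u p q -> loc_equiv_canonical U f x u p q (K f x u p q).
Proof.
  intros HU Hf HI H x0 u0 p0 q0 HU0.
  destruct (HU _ _ _ _ HU0) as [r [Hr HB]].
  set (B := box_domain x0 u0 p0 q0 r).
  assert (BU : forall x u p q, B x u p q -> U x u p q)
    by (intros x u p q [h1 [h2 [h3 h4]]]; auto).
  assert (Z : forall y, Rabs (y - y) < r) by (intro; now rewrite Rminus_diag, Rabs_R0).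
  assert (HfB := smooth4_subset U B f BU Hf).
  assert (HIB : forall x u p q, B x u p q -> I3 f x u p q <> 0) by auto.
  set (g := lift f HfB : sm B). assert (Rf := rep_lift f HfB : rep f g).
  set (j := hJ g). assert (Hj := unit_hJ f g Rf HIB).
  set (s := K f x0 u0 p0 q0).
  assert (V : forall F (G : sm B) c, rep F G ->
     (forall x u p q, U x u p q -> F x u p q = c) -> G = sm_const B c).
  { intros F G c HF HG. apply sm_ext; intro w. rewrite <- (HF w), val_const.
    apply HG, BU, pt_in. }
  assert (H6 := V _ _ 0 (rep_I6 f g Rf HIB) ltac:(intros; now apply H)).
  assert (H8 := V _ _ 0 (rep_I8 f g Rf HIB) ltac:(intros; now apply H)).
  assert (H10 := V _ _ 0 (rep_I10 f g Rf HIB) ltac:(intros; now apply H)).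
  assert (H11 := V _ _ 0 (rep_I11 f g Rf HIB) ltac:(intros; now apply H)).
  assert (H12 := V _ _ 0 (rep_I12 f g Rf HIB) ltac:(intros; now apply H)).
  assert (RK := rep_K f g Rf HIB).
  assert (dK : forall d, der d (hK g (hJ g)) = sm_const B 0).
  { intro d. apply (V _ _ _ (rep_pd d _ _ RK)). intros x u p q h.
    destruct (H x u p q h) as [_ [_ [_ [_ [_ HK]]]]]. destruct d; apply HK. }
  assert (HK : hK g (hJ g) = sm_const B s).
  { apply sm_ext; intro w. rewrite val_const. unfold s.
    set (w0 := Pt B x0 u0 p0 q0 (conj (Z _) (conj (Z _) (conj (Z _) (Z _))))).
    rewrite (RK w0 : K f x0 u0 p0 q0 = _).
    apply (const_of_grad x0 u0 p0 q0 r (hK g (hJ g))); [|exact (pt_in w)].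
    intros d x u p q h. pose proof (sm_is_pd d (hK g (hJ g)) (Pt B x u p q h)) as D.
    rewrite dK, val_const in D. exact D. }
  destruct (contact_exists x0 u0 p0 q0 r g j s Hj (hJ_cube f g Rf HIB) H6 H8 H10 H11 H12 HK)
    as [phi [psi [chi [kap [lam [Hlam [Pd [Pq [D1 [D2 [D3' [V1 V2]]]]]]]]]]]].
  change (box_domain x0 u0 p0 q0 r) with B
    in phi, psi, chi, kap, lam, Hlam, Pd, Pq, D1, D2, D3', V1, V2.
  destruct V1 as [V1u [V1p V1q]]. destruct V2 as [V2u [V2p V2q]].
  unfold O1, O2 in V1u, V1p, V1q, V2u, V2p, V2q. simpl in V1u, V1p, V1q, V2u, V2p, V2q.
  assert (Ha : unit (Dt g phi)) by (rewrite Pd; auto with unit).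
  assert (Psq : der Dq psi = sm_const B 0).
  { rewrite V1q, Pq. apply sm_ext; intro w; autorewrite with val; ring. }
  assert (Chq : der Dq chi = sm_const B 0).
  { rewrite V2q, Pq. apply sm_ext; intro w; autorewrite with val; ring. }
  assert (RPhi := rep_base _ _ _ _ _ Hr phi Pq).
  assert (RPsi := rep_base _ _ _ _ _ Hr psi Psq).
  assert (RChi := rep_base _ _ _ _ _ Hr chi Chq).
  assert (CPhi := fun d => cyl_val _ phi d RPhi).
  assert (CPsi := fun d => cyl_val _ psi d RPsi).
  assert (CChi := fun d => cyl_val _ chi d RChi).
  exists (box3 x0 u0 p0 r), (base _ _ _ _ _ phi), (base _ _ _ _ _ psi), (base _ _ _ _ _ chi), B.
  split; [|split; [apply open4_box | split; [now repeat split|]]].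
  - split; [exact (open3_box3 x0 u0 p0 q0 r Hr)|].
    split; [now apply smooth3_base|]. split; [now apply smooth3_base|].
    split; [now apply smooth3_base|].
    (* The vertical system does not contain the [dx] component of the contact condition; it is
       recovered from [D psi = a chi]. *)
    assert (PX : forall w : pt B, val (der Dx psi) w =
       (val chi w * val (der Dx phi) w - val lam w * pp w)%R).
    { intro w. assert (E := f_equal (fun F => val F w) D1). cbv beta in E.
      autorewrite with val in E. rewrite !val_Dt, V1u, V1p, Psq, Pq in E.
      autorewrite with val in E. lra. }
    split.
    + intros x u p h. set (w := Pt B x u p q0 (box3_box _ _ _ _ _ Hr x u p h)).
      unfold jac3. cbv zeta.
      rewrite <- (CPhi Dx w : _ = d3x _ x u p), <- (CPhi Du w : _ = d3u _ x u p),
        <- (CPhi Dp w : _ = d3p _ x u p), <- (CPsi Dx w : _ = d3x _ x u p),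
        <- (CPsi Du w : _ = d3u _ x u p), <- (CPsi Dp w : _ = d3p _ x u p),
        <- (CChi Dx w : _ = d3x _ x u p), <- (CChi Du w : _ = d3u _ x u p),
        <- (CChi Dp w : _ = d3p _ x u p).
      assert (E := f_equal (fun F => val F w) D2). cbv beta in E.
      autorewrite with val in E. rewrite val_Dt, V2u, V2p, Chq in E.
      rewrite PX, V1u, V1p, V2u, V2p. autorewrite with val in E |- *.
      rewrite val_inv in E |- * by auto.
      assert (Na := Ha w). assert (Nl := Hlam w).
      assert (Ea := val_Dt g phi w). rewrite Pq, val_const in Ea.
      (* The [x]-derivatives of [chi] and [phi] are expressed through [D]. In the coframe [dx],
         [du - p dx], [dp - q dx] the three differentials are triangular up to row operations, with
         diagonal [a], [lam], [lam / a]; hence the Jacobian [lam^2]. *)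
      match type of E with (?X + ?Y + ?T + ?S = ?Q)%R =>
        replace X with (Q - Y - T - S)%R by lra end.
      replace (val (der Dx phi) w) with
        (val (Dt g phi) w - pp w * val (der Du phi) w - pq w * val (der Dp phi) w)%R by lra.
      match goal with |- ?X <> 0 => replace X with (val lam w * val lam w)%R by (field; auto) end.
      now apply Rmult_integral_contrapositive_currified.
    + exists (base _ _ _ _ _ lam). intros x u p h.
      set (w := Pt B x u p q0 (box3_box _ _ _ _ _ Hr x u p h)).
      rewrite <- (CPhi Dx w : _ = d3x _ x u p), <- (CPhi Du w : _ = d3u _ x u p),
        <- (CPhi Dp w : _ = d3p _ x u p), <- (CPsi Dx w : _ = d3x _ x u p),
        <- (CPsi Du w : _ = d3u _ x u p), <- (CPsi Dp w : _ = d3p _ x u p).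
      change (base _ _ _ _ _ lam x u p) with (val lam w).
      change (base _ _ _ _ _ chi x u p) with (val chi w).
      rewrite PX, V1u, V1p. autorewrite with val.
      change (pp w) with p. repeat split; ring.
  - intros x u p q h. set (w := Pt B x u p q h).
    split; [now apply BU|]. split; [destruct h as [h1 [h2 [h3 h4]]]; now repeat split|].
    assert (EP := D3_val g _ phi RPhi w : D3 _ x u p q = _).
    split; [rewrite EP; apply Ha|].
    assert (RQ : rep (qbar (base _ _ _ _ _ phi) (base _ _ _ _ _ chi)) kap).
    { intro v. unfold qbar. rewrite (D3_val g _ phi RPhi v), (D3_val g _ chi RChi v), D2.
      autorewrite with val. field. apply Ha. }
    unfold rbar. rewrite EP, (rep_Dhat f g Rf _ _ RQ w : Dhat f _ x u p q = _), D3'.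
    rewrite (RChi w : base _ _ _ _ _ chi x u p = _), (RPsi w : base _ _ _ _ _ psi x u p = _).
    autorewrite with val. change (box_domain x0 u0 p0 q0 r) with B. field. apply Ha.
Qed.

Theorem theorem3p1 (U : set4) (f : fun4)
  (HU : open4 U) (Hf : smooth4 U f)
  (HI3 : forall x u p q, U x u p q -> I3 f x u p q <> 0) :
  ((forall x u p q, U x u p q -> exists s, loc_equiv_canonical U f x u p q s)
   <->
   (forall x u p q, U x u p q ->
      I6 f x u p q = 0 /\ I8 f x u p q = 0 /\ I10 f x u p q = 0 /\
      I11 f x u p q = 0 /\ I12 f x u p q = 0 /\
      fx (K f) x u p q = 0 /\ fu (K f) x u p q = 0 /\
      fp (K f) x u p q = 0 /\ fq (K f) x u p q = 0))
  /\
  (forall x u p q s, U x u p q -> loc_equiv_canonical U f x u p q s ->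
     s = K f x u p q).
Proof.
  split; [split|].
  - intros H x u p q h. destruct (H x u p q h) as [s Hs].
    exact (proj1 (invariants_of_loc_equiv U f x u p q s Hf HI3 Hs)).
  - intros H x u p q h. exists (K f x u p q). now apply loc_equiv_of_invariants.
  - intros x u p q s _ Hs. exact (proj2 (invariants_of_loc_equiv U f x u p q s Hf HI3 Hs)).
Qed.
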